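(* Let $n\ge1$, $0<p<1$, $\nu\in\mathbb{R}$, $\sigma\in J_n^+$, and let $V(x,t)=\zeta(t)(1+t)^\nu|x|^\sigma$ where $\zeta>0$ is continuous with $\lim_{t\to\infty}t^\delta\zeta(t)=\infty$ and $\lim_{t\to\infty}t^{-\delta}\zeta(t)=0$ for every $\delta>0$, and, in case $\sigma>0$, $\zeta(t)(1+t)^\nu\in\mathcal{E}_\varepsilon$ for some $\varepsilon\in(0,1)$. Let $a=a_c=\frac{\sigma+2(\nu+1)_+}{1-p}$ and let $u_0\ge0$ be continuous with $\liminf_{|x|\to\infty}|x|^{-a}u_0(x)=l_1$, $\limsup_{|x|\to\infty}|x|^{-a}u_0(x)=l_2$, $l_1,l_2\in(0,\infty)$. Let $u$ be the global s-solution of $\partial_tu-\Delta\partial_tu=\Delta u+Vu^p$, $u(\cdot,0)=u_0$, and fix $R>0$. Then there is $\underline C>0$ and, for every $\varepsilon'>0$, a constant $\overline C_{\varepsilon'}>0$ such that $$\underline C\,l_1\,t^{a/2}\le\|u(\cdot,t)\|_{R,a}\le\overline C_{\varepsilon'}\,l_2\,t^{a/2+\varepsilon'}\quad\text{for all sufficiently large }t.$$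
   Context: $J_n^+=\{0\}\cup[1,\infty)$ if $n=1$, $[0,\infty)$ if $n\ge2$; $s_+=\max\{s,0\}$. $\|\varphi\|_{R,a}=\sup_x(R^2+|x|^2)^{-a/2}|\varphi(x)|$. $\mathcal{E}_\varepsilon$ is the set of continuous positive $\Lambda$ for which there are $c,t_0>0$ with $\int_0^{\varepsilon t}\Lambda\ge c\int_0^t\Lambda$ for all $t\ge t_0/\varepsilon$. $\mathcal{B}\varphi=B*\varphi$ with $B=\mathcal{F}^{-1}((1+|\xi|^2)^{-1})$. A global s-solution is $u\ge0$ with $\mu=e^tu\in C([0,\infty);BC_{a})$ ($BC_a$: continuous functions bounded by $C|x|^{a}$ at infinity) and $\mu(t)=u_0+\int_0^t\mathcal{B}\mu\,d\tau+\int_0^te^{(1-p)\tau}\mathcal{B}[V\mu^p]\,d\tau$; it exists and is unique under these hypotheses. *)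

(* Defs.v *)
From HB Require Import structures.
From mathcomp Require Import all_boot all_order all_algebra.
From mathcomp Require Import all_classical all_reals all_analysis.
Set Implicit Arguments. Unset Strict Implicit. Unset Printing Implicit Defensive.
Import Order.TTheory GRing.Theory Num.Theory numFieldNormedType.Exports.
Local Open Scope classical_set_scope.
Local Open Scope ring_scope.

Section Defs.
Variable R : realType.

Definition Rint (D : set R) (f : R -> R) : R :=
  Rintegral (@lebesgue_measure R) D f.

Definition enorm (n : nat) (x : 'rV[R]_n) : R :=
  Num.sqrt (\sum_(i < n) x ord0 i ^+ 2).

(* Integral over R^n, realised as the iterated Lebesgue integral over the
   coordinates (Fubini): int_{R^{n+1}} f = int_R (int_{R^n} f(y, .)) dy. *)
Fixpoint intRn (n : nat) : ('rV[R]_n -> R) -> R :=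
  match n return ('rV[R]_n -> R) -> R with
  | 0%N => fun f => f 0
  | n'.+1 => fun f : 'rV[R]_(1 + n') -> R =>
      Rint setT (fun y => intRn (fun x : 'rV[R]_n' =>
        f (row_mx (const_mx y : 'rV[R]_1) x)))
  end.

(* The kernel B = F^{-1}((1+|xi|^2)^{-1}) on R^n (Bessel potential G_2),
   written through its standard subordination formula
   B(x) = int_0^oo e^{-s} (4 pi s)^{-n/2} e^{-|x|^2/(4s)} ds. *)
Definition besselB (n : nat) (x : 'rV[R]_n) : R :=
  Rint `]0, +oo[ (fun s => expR (- s) * (4 * pi * s) `^ (- (n%:R / 2))
                          * expR (- (enorm x ^+ 2 / (4 * s)))).

Definition opB (n : nat) (phi : 'rV[R]_n -> R) (x : 'rV[R]_n) : R :=
  intRn (fun y => besselB (x - y) * phi y).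

Definition wnorm (n : nat) (rho a : R) (phi : 'rV[R]_n -> R) : R :=
  sup [set (rho ^+ 2 + enorm x ^+ 2) `^ (- (a / 2)) * `|phi x| | x in [set: 'rV[R]_n]].

(* BC_a : continuous functions bounded by C |x|^a at infinity
   (equivalently |phi x| <= C (1+|x|^2)^{a/2} everywhere). *)
Definition BC (n : nat) (a : R) (phi : 'rV[R]_n -> R) : Prop :=
  continuous phi /\
  exists C : R, forall x, `|phi x| <= C * (1 + enorm x ^+ 2) `^ (a / 2).

Definition Jplus (n : nat) (s : R) : Prop :=
  if n == 1%N then s = 0 \/ 1 <= s else 0 <= s.

Definition classE (eps : R) (L : R -> R) : Prop :=
  {within `[0, +oo[, continuous L} /\ (forall t, 0 <= t -> 0 < L t) /\
  exists c t0 : R, 0 < c /\ 0 < t0 /\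
    forall t, t0 / eps <= t -> c * Rint `[0, t] L <= Rint `[0, eps * t] L.

Definition liminf_infty (n : nat) (f : 'rV[R]_n -> R) (l : R) : Prop :=
  (forall e : R, 0 < e -> exists M : R, forall x, M <= enorm x -> l - e <= f x) /\
  (forall e : R, 0 < e -> forall M : R, exists x, M <= enorm x /\ f x <= l + e).

Definition limsup_infty (n : nat) (f : 'rV[R]_n -> R) (l : R) : Prop :=
  (forall e : R, 0 < e -> exists M : R, forall x, M <= enorm x -> f x <= l + e) /\
  (forall e : R, 0 < e -> forall M : R, exists x, M <= enorm x /\ l - e <= f x).

(* Global s-solution u (u x t = u(x,t)) of
   d_t u - Lap d_t u = Lap u + V u^p,  u(.,0) = u0,
   with mu = e^t u in C([0,oo); BC_a). *)
Definition s_solution (n : nat) (p a : R) (V : 'rV[R]_n -> R -> R)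
  (u0 : 'rV[R]_n -> R) (u : 'rV[R]_n -> R -> R) : Prop :=
  let mu := fun t x => expR t * u x t in
  (forall x t, 0 <= t -> 0 <= u x t) /\
  (forall t, 0 <= t -> BC a (mu t)) /\
  (forall t0, 0 <= t0 -> forall e : R, 0 < e -> exists d : R, 0 < d /\
     forall t, 0 <= t -> `|t - t0| < d -> wnorm 1 a (mu t - mu t0) < e) /\
  (forall t x, 0 <= t ->
     mu t x = u0 x + Rint `[0, t] (fun tau => opB (mu tau) x)
              + Rint `[0, t] (fun tau => expR ((1 - p) * tau) *
                                opB (fun y => V y tau * mu tau y `^ p) x)).

End Defs.

(* Main.v *)
Require Import Defs.
From HB Require Import structures.
From mathcomp Require Import all_boot all_order all_algebra.
From mathcomp Require Import all_classical all_reals all_analysis.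
From mathcomp Require Import measurable_realfun ring lra.
Set Implicit Arguments. Unset Strict Implicit. Unset Printing Implicit Defensive.
Import Order.TTheory GRing.Theory Num.Theory numFieldNormedType.Exports.
Local Open Scope classical_set_scope.
Local Open Scope ring_scope.

(** Write B for convolution with the Bessel kernel, so that mu = e^t u solves
    mu' = B mu + e^{(1-p)t} B[V mu^p].

    Upper bound. For M >= a/2 and th = a/(2M), the weight
    H_L(x) = (L^M + sum_i x_i^{2M})^th satisfies B H_L <= (1 + C/L) H_L: the
    tangent line of r |-> r^th reduces this to the even moments of the kernel.
    Fix a horizon T and take L of order 1 + T. The function
    A e^t (1+t)^k H_L, with A large, is then a supersolution on [0, T]. If mu
    is at most Phi >= 1 times it, the integral equation and p < 1 give the
    smaller factor Phi - (Phi - 1)/(e^T (1+T)^k); hence Phi = 1 is admissible.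
    At time T, H_L is at most of order T^{a/2} (1 + |x|^2)^{a/2}.

    Lower bound. Outside a large ball u0 >= c |x|^a, so
    u0 >= c r^a (1/3 - 2/3 cos(x_1/r)) for r large. The cosine is an eigenfunction
    of B with eigenvalue 1 - D, D >= c'/r^2, so the linear equation can be solved
    explicitly from this datum; comparison at x = 0 with r^2 of order t gives
    u(0, t) >= c'' t^{a/2}.

    In both parts mu is only compared with explicit functions. Integrals of
    nonnegative functions are monotone without measurability, so no
    measurability in time of B mu is needed. *)

(** * Integrals of nonnegative functions and Gaussian kernels *)

(** [Rint] returns 0 when the underlying integral is infinite, and for n >= 2 the kernel is infinite
    at the origin. Upper bounds survive this convention; each lower bound requires a proof that the
    integral is finite. The functions to be convolved come from an unknown solution, so the
    integrals actually evaluated are those of explicit majorants and minorants: mixtures over s of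
    products of one-dimensional heat kernels, whose coordinates are integrated out one at a time.
    Even powers serve because a symmetric kernel cancels odd moments: convolving x_i^{2M} adds only
    terms of degree 2M - 2, smaller than L^M + sum_i x_i^{2M} by a factor 1/L. With L a large
    multiple of 1 + T, the loss C/L is at most k/(2(1 + s)) for s <= T, which the growth of (1 +
    s)^k pays for. Together with the slow growth of zeta this is the origin of the exponent loss, k
    being that loss. As for 1/3 and 2/3: 1/3 - 2/3 cos is nonpositive where cos >= 1/2 and never
    exceeds 1, and once the cosine mode has dropped to a quarter of e^t the value at 0 is still
    e^t/6. *)

Section integral_without_measurability.
Context d (T : measurableType d) (R : realType).
Variable mu : {measure set T -> \bar R}.
Local Open Scope ereal_scope.

(* The integral of a nonnegative function is a supremum over simple functions
   below it, so monotonicity requires no measurability. *)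
Lemma ge0_le_integral_nomeas (D : set T) (f g : T -> \bar R) :
  (forall x, D x -> 0 <= f x) -> (forall x, D x -> f x <= g x) ->
  \int[mu]_(x in D) f x <= \int[mu]_(x in D) g x.
Proof.
move=> f0 fg.
have g0 x : D x -> 0 <= g x by move=> Dx; apply: le_trans (fg x Dx); exact: f0.
rewrite !ge0_integralE//.
apply: ge_ereal_sup => _ /= [h hf <-]; apply: ereal_sup_ubound.
exists h => // x; apply: le_trans (hf x) _.
by rewrite /patch; case: ifPn => //; rewrite inE => /fg.
Qed.

(** If the integral of f is infinite, [Rintegral] is 0 and the bound still holds. *)
Lemma Rintegral_le_integral (D : set T) (f : T -> R) (g : T -> \bar R) :
  (forall x, D x -> (0 <= f x)%R) -> (forall x, D x -> (f x)%:E <= g x) ->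
  (Rintegral mu D f)%:E <= \int[mu]_(x in D) g x.
Proof.
move=> f0 fg; have f0' x : D x -> 0 <= (f x)%:E by move/f0; rewrite lee_fin.
have := @ge0_le_integral_nomeas D _ _ f0' fg; rewrite /Rintegral.
have := @integral_ge0 _ _ _ mu D _ f0'.
by case: (integral _ _ _) => [r _ //|_ gy|//]; apply: le_trans gy; rewrite leey.
Qed.

(** Here finiteness is indispensable: an infinite integral of f would be read as 0. *)
Lemma integral_le_Rintegral (D : set T) (f : T -> R) (g : T -> \bar R) :
  (forall x, D x -> 0 <= g x) -> (forall x, D x -> g x <= (f x)%:E) ->
  \int[mu]_(x in D) (f x)%:E < +oo ->
  \int[mu]_(x in D) g x <= (Rintegral mu D f)%:E.
Proof.
move=> g0 gf foo; have f0 x : D x -> 0 <= (f x)%:E.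
  by move=> Dx; apply: le_trans (gf x Dx); exact: g0.
rewrite /Rintegral fineK; first exact: ge0_le_integral_nomeas.
by rewrite ge0_fin_numE//; exact: integral_ge0.
Qed.

End integral_without_measurability.

Section gaussian.
Variable R : realType.
Local Notation mu := (@lebesgue_measure R).
Local Open Scope ereal_scope.

(** The image of Lebesgue measure under the reflection agrees with it on the intervals []a, b]],
    which determine it. *)
Lemma ge0_integral_reflect (c : R) (f : R -> \bar R) :
  measurable_fun [set: R] f -> (forall r, 0 <= f r) ->
  \int[mu]_r f r = \int[mu]_r f (c - r)%R.
Proof.
move=> mf f0.
have mphi : measurable_fun [set: R] (fun r : R => (c - r)%R).
  by apply: measurable_funB => //; exact: measurable_id.
have phiE A : measurable A ->
    pushforward mu (fun r : R => (c - r)%R : measurableTypeR R) A = mu A.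
  move=> mA; apply/esym/lebesgue_measure_unique => //= _ [[a b]] _ <-.
  rewrite /pushforward.
  have -> : ((fun r : R => (c - r)%R : measurableTypeR R) @^-1` `]a, b]) =
      `[(c - b)%R, (c - a)%R[%classic.
    by apply/seteqP; split => x /=; rewrite !in_itv/= => /andP[? ?];
      apply/andP; split; lra.
  rewrite !lebesgue_measure_itv/= !lte_fin.
  rewrite (_ : (c - b < c - a)%R = (a < b)%R); last by apply/idP/idP => ?; lra.
  by case: ifP => // _; rewrite -!EFinD; congr EFin; lra.
transitivity (\int[pushforward mu (fun r : R => (c - r)%R : measurableTypeR R)]_r f r).
  by apply: eq_measure_integral => //= A mA AS; exact/esym/phiE.
by rewrite ge0_integral_pushforward.
Qed.

Lemma tonelli_swap (f : R -> R -> R) :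
  measurable_fun [set: R * R] (fun q => f q.1 q.2) -> (forall x y, 0 <= f x y)%R ->
  \int[mu]_x \int[mu]_y (f x y)%:E = \int[mu]_y \int[mu]_x (f x y)%:E.
Proof.
move=> mf f0.
pose F := fun q : R * R => (f q.1 q.2)%:E.
have mF : measurable_fun [set: R * R] F by exact/measurable_EFinP.
have F0 q : 0 <= F q by rewrite lee_fin.
by rewrite -[LHS](@fubini_tonelli1 _ _ _ _ _ mu mu F mF F0) (@fubini_tonelli2 _ _ _ _ _ mu mu F mF F0).
Qed.

Local Close Scope ereal_scope.

(** The heat kernel at time s, that is, the centred normal density of variance 2 s. Powers of s go
    through [powR], whose measurability gives joint measurability in s and z. *)
Definition gk (s z : R) : R :=
  (4 * pi * s) `^ (- (2^-1)) * expR (- (z ^+ 2 / 4 * s `^ (-1))).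

Lemma gk_ge0 s z : 0 <= gk s z.
Proof. by rewrite mulr_ge0 ?powR_ge0 ?expR_ge0. Qed.

Lemma gkN s z : gk s (- z) = gk s z.
Proof. by rewrite /gk sqrrN. Qed.

Lemma measurable_gk2 d (T : measurableType d) (f g : T -> R) :
  measurable_fun setT f -> measurable_fun setT g ->
  measurable_fun setT (fun q => gk (f q) (g q)).
Proof.
move=> mf mg; apply: measurable_funM.
  apply: (measurableT_comp (measurable_powR (- (2^-1)))).
  exact: measurable_funM.
apply: measurableT_comp => //; apply: measurableT_comp => //.
apply: measurable_funM.
  by apply: measurable_funM => //; exact: measurable_funX.
exact: (measurableT_comp (measurable_powR (-1))).
Qed.

Lemma gk_normal_pdf s x y : 0 < s -> gk s (x - y) = normal_pdf x (Num.sqrt (2 * s)) y.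
Proof.
move=> s0; have h : Num.sqrt (2 * s) != 0 by rewrite gt_eqF// sqrtr_gt0 mulr_gt0.
rewrite normal_pdfE// /normal_peak /normal_fun.
rewrite sqr_sqrtr; last by rewrite ltW// mulr_gt0.
rewrite /gk powRN powR12_sqrt; last by rewrite !mulr_ge0 ?pi_ge0// ltW.
congr (_^-1 * expR _).
  by congr Num.sqrt; rewrite -mulr_natl; ring.
by rewrite powR_inv1 ?ltW// -mulr_natl; field; rewrite gt_eqF.
Qed.

Lemma integral_gk s x : 0 < s -> (\int[mu]_y (gk s (x - y))%:E = 1)%E.
Proof.
move=> s0; rewrite -(@integral_normal_pdf _ x (Num.sqrt (2 * s))).
by apply: eq_integral => y _; rewrite gk_normal_pdf.
Qed.

Lemma integral_gk0 s : 0 < s -> (\int[mu]_y (gk s y)%:E = 1)%E.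
Proof.
move=> s0; rewrite -(integral_gk 0 s0).
by apply: eq_integral => y _; rewrite sub0r gkN.
Qed.

Lemma measurable_gkr s : measurable_fun [set: R] (gk s).
Proof. by apply: measurable_gk2 => //; exact: measurable_id. Qed.

(** Averaging the two forms of the convolution, related by z -> -z, cancels the part of c that is
    odd about x. The kernel may take infinite values. *)
Lemma even_conv_sym (k : R -> \bar R) x (c : R -> R) :
  measurable_fun setT k -> (forall z, 0 <= k z)%E -> (forall z, k (- z) = k z) ->
  measurable_fun setT c -> (forall y, 0 <= c y) ->
  (\int[mu]_y ((c y)%:E * k (x - y)%R) =
   \int[mu]_z (((c (x - z)%R + c (x + z)%R) / 2)%:E * k z))%E.
Proof.
move=> mk k0 kN mc c0.
have ms : measurable_fun setT (fun z : R => x - z) by exact: measurable_funB.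
have ma : measurable_fun setT (fun z : R => x + z) by exact: measurable_funD.
have mcx (f : R -> R) : measurable_fun setT f ->
    measurable_fun setT (fun z => (c (f z))%:E * k z)%E.
  move=> mf; apply: emeasurable_funM => //; apply/measurable_EFinP.
  exact: (measurableT_comp mc).
have E1 : (\int[mu]_y ((c y)%:E * k (x - y)%R) = \int[mu]_z ((c (x - z)%R)%:E * k z))%E.
  rewrite (@ge0_integral_reflect x).
  - by apply: eq_integral => z _; congr (_ * k _)%E; ring.
  - apply: emeasurable_funM; first exact/measurable_EFinP.
    exact: (measurableT_comp mk).
  - by move=> r; rewrite mule_ge0 ?lee_fin.
have E2 : (\int[mu]_z ((c (x - z)%R)%:E * k z) = \int[mu]_z ((c (x + z)%R)%:E * k z))%E.
  rewrite (@ge0_integral_reflect 0).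
  - by apply: eq_integral => z _; rewrite sub0r kN opprK.
  - exact: mcx.
  - by move=> r; rewrite mule_ge0 ?lee_fin.
transitivity (\int[mu]_z ((2^-1%R)%:E *
    ((c (x - z)%R)%:E * k z + (c (x + z)%R)%:E * k z)))%E; last first.
  apply: eq_integral => z _; rewrite -ge0_muleDl ?lee_fin// muleA; congr (_ * _)%E.
  by rewrite -EFinD -EFinM; congr EFin; field.
rewrite ge0_integralZl_EFin//; last 2 first.
- by move=> z _; apply: adde_ge0; rewrite mule_ge0 ?lee_fin.
- by apply: emeasurable_funD; exact: mcx.
rewrite ge0_integralD//; last 4 first.
- by move=> z _; rewrite mule_ge0 ?lee_fin.
- exact: mcx.
- by move=> z _; rewrite mule_ge0 ?lee_fin.
- exact: mcx.
(* The integral I may be infinite; half of I + I is I in either case. *)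
rewrite -E2 E1; set I := integral _ _ _.
have : (0 <= I)%E by apply: integral_ge0 => z _; rewrite mule_ge0 ?lee_fin.
case: I => [r r0|_|//].
  by rewrite -EFinD -EFinM; congr EFin; field.
by rewrite addye// gt0_muley// lte_fin.
Qed.

Lemma gk_conv_sym s x (c : R -> R) : measurable_fun setT c -> (forall y, 0 <= c y) ->
  (\int[mu]_y (gk s (x - y) * c y)%:E =
   \int[mu]_z (gk s z * ((c (x - z) + c (x + z)) / 2))%:E)%E.
Proof.
move=> mc c0.
transitivity (\int[mu]_y ((c y)%:E * (gk s (x - y))%:E))%E.
  by apply: eq_integral => y _; rewrite -EFinM mulrC.
rewrite (@even_conv_sym (fun z => (gk s z)%:E))//.
- by apply: eq_integral => y _; rewrite -EFinM mulrC.
- by apply/measurable_EFinP; exact: measurable_gkr.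
- by move=> z; rewrite lee_fin gk_ge0.
- by move=> z; rewrite gkN.
Qed.

End gaussian.

(** * Even moments of the heat kernel *)

Section moments.
Variable R : realType.
Local Notation mu := (@lebesgue_measure R).

(** Second-order Taylor remainder with a crude constant: its square form closes the induction
    through (k+2)^2 + (k+2) <= (k+3)^2. *)
Lemma exprD_remainder (x z : R) k :
  `|(x + z) ^+ k.+2 - x ^+ k.+2 - k.+2%:R * x ^+ k.+1 * z| <=
  k.+2%:R ^+ 2 * z ^+ 2 * (`|x| + `|z|) ^+ k.
Proof.
elim: k => [|k IH].
  rewrite expr0 expr1 mulr1 (_ : _ - _ = z ^+ 2); last by ring.
  by rewrite ger0_norm ?sqr_ge0// ler_peMl ?sqr_ge0//; lra.
have -> : (x + z) ^+ k.+3 - x ^+ k.+3 - k.+3%:R * x ^+ k.+2 * z =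
    (x + z) * ((x + z) ^+ k.+2 - x ^+ k.+2 - k.+2%:R * x ^+ k.+1 * z) +
    k.+2%:R * z ^+ 2 * x ^+ k.+1.
  by rewrite -(natr1 k.+2) !exprS; ring.
apply: le_trans (ler_normD _ _) _.
rewrite (normrM (x + z)) (normrM _ (x ^+ k.+1)) (normrM k.+2%:R) normr_nat.
have h1 : `|x + z| * `|(x + z) ^+ k.+2 - x ^+ k.+2 - k.+2%:R * x ^+ k.+1 * z| <=
    k.+2%:R ^+ 2 * z ^+ 2 * (`|x| + `|z|) ^+ k.+1.
  rewrite [(_ + _) ^+ k.+1]exprS [leRHS]mulrCA.
  by apply: ler_pM => //; exact: ler_normD.
have h2 : k.+2%:R * `|z ^+ 2| * `|x ^+ k.+1| <=
    k.+2%:R * z ^+ 2 * (`|x| + `|z|) ^+ k.+1.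
  rewrite (ger0_norm (sqr_ge0 z)) normrX ler_wpM2l ?(sqr_ge0, mulr_ge0)//.
  by rewrite lerXn2r ?nnegrE ?addr_ge0// lerDl.
apply: le_trans (lerD h1 h2) _.
rewrite -mulrDl -mulrDl ler_wpM2r ?exprn_ge0 ?addr_ge0//.
rewrite ler_wpM2r ?sqr_ge0// -(natr1 k.+2).
have : 0 <= k.+2%:R :> R by []. by nra.
Qed.

(** The first-order terms in z and -z cancel, so the excess over x^{2N+2} has degree only 2N in x.
    The factor 1 + z^{2N+2} dominates both z^2 and z^{2N+2}. *)
Lemma even_power_average (x z : R) N :
  (((x - z) ^+ 2) ^+ N.+1 + ((x + z) ^+ 2) ^+ N.+1) / 2 <=
  (x ^+ 2) ^+ N.+1 + (N.*2.+2%:R ^+ 2 * 2 ^+ N.*2) *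
    (1 + (x ^+ 2) ^+ N) * (1 + (z ^+ 2) ^+ N.+1).
Proof.
have E (y : R) : (y ^+ 2) ^+ N.+1 = y ^+ N.*2.+2 by rewrite -exprM mul2n.
have E' (y : R) : (y ^+ 2) ^+ N = `|y| ^+ N.*2.
  by rewrite -exprM mul2n -mul2n !exprM real_normK ?num_real.
have := exprD_remainder x z N.*2; have := exprD_remainder x (- z) N.*2.
rewrite !ler_norml normrN sqrrN => /andP[_ h1] /andP[_ h2].
set A := (N.*2.+2%:R ^+ 2).
have A0 : 0 <= A by rewrite /A sqr_ge0.
have h3 : (((x - z) ^+ 2) ^+ N.+1 + ((x + z) ^+ 2) ^+ N.+1) / 2 <=
    (x ^+ 2) ^+ N.+1 + A * z ^+ 2 * (`|x| + `|z|) ^+ N.*2.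
  by rewrite !E; move: h1 h2; rewrite -/A; lra.
apply: le_trans h3 _; rewrite lerD2l; move: A A0 => A A0.
rewrite -(mulrA A (z ^+ 2)) -(mulrA A (2 ^+ _)) -(mulrA A) ler_wpM2l//.
rewrite -(mulrA (2 ^+ _)).
have h4 : (`|x| + `|z|) ^+ N.*2 <= 2 ^+ N.*2 * ((x ^+ 2) ^+ N + (z ^+ 2) ^+ N).
  rewrite !E'; have [xz|zx] := leP `|x| `|z|.
    apply: (@le_trans _ _ ((2 * `|z|) ^+ N.*2)).
      by rewrite lerXn2r ?nnegrE ?addr_ge0 ?mulr_ge0//; lra.
    by rewrite exprMn ler_wpM2l ?exprn_ge0// lerDr exprn_ge0.
  apply: (@le_trans _ _ ((2 * `|x|) ^+ N.*2)).
    by rewrite lerXn2r ?nnegrE ?addr_ge0 ?mulr_ge0//; lra.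
  by rewrite exprMn ler_wpM2l ?exprn_ge0// lerDl exprn_ge0.
apply: le_trans (ler_wpM2l (sqr_ge0 z) h4) _; rewrite mulrCA ler_wpM2l ?exprn_ge0//.
have x0 : 0 <= (x ^+ 2) ^+ N by rewrite exprn_ge0// sqr_ge0.
have z0 : 0 <= z ^+ 2 by rewrite sqr_ge0.
have h5 : z ^+ 2 <= 1 + (z ^+ 2) ^+ N.+1.
  have [z1|z1] := leP (z ^+ 2) 1.
    by apply: le_trans z1 _; rewrite lerDl exprn_ge0.
  have w1 : 1 <= (z ^+ 2) ^+ N by rewrite exprn_ege1// ltW.
  by rewrite (exprS (z ^+ 2) N); have := ler_peMr z0 w1; lra.
have h6 : z ^+ 2 * (z ^+ 2) ^+ N = (z ^+ 2) ^+ N.+1 by rewrite (exprS (z ^+ 2) N).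
rewrite mulrDr h6; move: (z ^+ 2) (x ^+ 2 ^+ N) x0 z0 h5 {h6} => Z X X0 Z0 h5.
have := exprn_ge0 N.+1 Z0; have := ler_wpM2r X0 h5; lra.
Qed.

Lemma exprn_le_expR (x : R) n : 0 <= x -> x ^+ n <= n`!%:R * expR x.
Proof.
case: n => [|n] x0; first by rewrite expr0 fact0 mul1r; have := @expR_ge1Dx R x; lra.
have := @expR_ge1Dxn R x n x0.
have f0 : 0 < n.+1`!%:R :> R by rewrite ltr0n fact_gt0.
move=> h; have : x ^+ n.+1 / n.+1`!%:R <= expR x by lra.
by rewrite ler_pdivrMr// mulrC.
Qed.

Lemma gk_le_rate (s z : R) : gk s z <= (4 * pi * s) `^ (- (2^-1)).
Proof.
rewrite /gk -[leRHS]mulr1 ler_wpM2l ?powR_ge0// expR_le1 oppr_le0.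
by rewrite mulr_ge0 ?powR_ge0// divr_ge0 ?sqr_ge0.
Qed.

(** With q = z^2/(8 s) the Gaussian exponential is e^{-q} e^{-q}: one factor absorbs q^N at the cost
    of N!, the other belongs to the kernel at time 2 s. The leading 2 covers the ratio sqrt 2 of the
    prefactors. *)
Lemma gk_moment_pointwise N (s z : R) : 0 < s ->
  gk s z * (z ^+ 2) ^+ N <= 2 * N`!%:R * 8 ^+ N * s ^+ N * gk (2 * s) z.
Proof.
move=> s0; set q := z ^+ 2 / (8 * s).
have q0 : 0 <= q by rewrite divr_ge0 ?sqr_ge0// ltW// mulr_gt0.
have -> : (z ^+ 2) ^+ N = 8 ^+ N * s ^+ N * q ^+ N.
  by rewrite -!exprMn /q; congr (_ ^+ N); field; rewrite gt_eqF.
have p4 : 0 <= 4 * pi * s :> R by rewrite !mulr_ge0 ?pi_ge0// ltW.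
have p8 : 0 <= 4 * pi * (2 * s) :> R by rewrite !mulr_ge0 ?pi_ge0// ltW.
have hr : (4 * pi * s) `^ (- (2^-1)) <= 2 * (4 * pi * (2 * s)) `^ (- (2^-1)).
  rewrite !powRN !powR12_sqrt//.
  have h4 : 0 < Num.sqrt (4 * pi * s) by rewrite sqrtr_gt0 !mulr_gt0 ?pi_gt0.
  have h8 : 0 < Num.sqrt (4 * pi * (2 * s)) by rewrite sqrtr_gt0 !mulr_gt0 ?pi_gt0.
  rewrite ler_pdivlMr// mulrC ler_pdivrMr//.
  rewrite -[leRHS]ger0_norm; last by rewrite mulr_ge0// ltW.
  rewrite -sqrtr_sqr ler_wsqrtr// exprMn sqr_sqrtr//.
  by have := pi_gt0 R; nra.
have -> : gk s z = (4 * pi * s) `^ (- (2^-1)) * (expR (- q) * expR (- q)).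
  rewrite /gk -expRD; congr (_ * expR _).
  by rewrite powR_inv1 ?ltW// /q; field; rewrite gt_eqF.
have -> : gk (2 * s) z = (4 * pi * (2 * s)) `^ (- (2^-1)) * expR (- q).
  rewrite /gk; congr (_ * expR _).
  by rewrite powR_inv1 ?mulr_ge0 ?ltW// /q; field; rewrite gt_eqF.
set r1 := (_ `^ _) in hr *; set r2 := (_ `^ _) in hr *.
have r10 : 0 <= r1 by exact: powR_ge0.
have r20 : 0 <= r2 by exact: powR_ge0.
have e0 := expR_ge0 (- q).
have hq : expR (- q) * q ^+ N <= N`!%:R.
  rewrite expRN mulrC ler_pdivrMr ?expR_gt0//; exact: exprn_le_expR.
have S0 : 0 <= 8 ^+ N * s ^+ N :> R by rewrite mulr_ge0 ?exprn_ge0// ltW.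
have -> : r1 * (expR (- q) * expR (- q)) * (8 ^+ N * s ^+ N * q ^+ N) =
  (8 ^+ N * s ^+ N * expR (- q)) * (r1 * (expR (- q) * q ^+ N)) by ring.
have -> : 2 * N`!%:R * 8 ^+ N * s ^+ N * (r2 * expR (- q)) =
  (8 ^+ N * s ^+ N * expR (- q)) * ((2 * r2) * N`!%:R) by ring.
rewrite ler_wpM2l ?mulr_ge0 ?exprn_ge0//.
by rewrite ltW.
apply: ler_pM => //.
by rewrite mulr_ge0// exprn_ge0.
Qed.

(* Constant in front of the lower-order terms of the Gaussian average of
   y ^ (2 N + 2). *)
Definition CQ N : R := (N.*2.+2%:R ^+ 2 * 2 ^+ N.*2) * (1 + 2 * N.+1`!%:R * 8 ^+ N.+1).

(** Majorant of the Gaussian average of y^{2N+2} about x. The absolute value keeps it nonnegative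
    for every real s. *)
Definition Qgk N (s x : R) : R :=
  (x ^+ 2) ^+ N.+1 + CQ N * (1 + (x ^+ 2) ^+ N) * (1 + `|s| ^+ N.+1).

Lemma CQ_ge0 N : 0 <= CQ N.
Proof. by rewrite mulr_ge0 ?addr_ge0 ?mulr_ge0 ?exprn_ge0. Qed.

Lemma Qgk_ge0 N s x : 0 <= Qgk N s x.
Proof.
apply: addr_ge0; first by rewrite ?(sqr_ge0, exprn_ge0).
by apply: mulr_ge0; [apply: mulr_ge0; [exact: CQ_ge0|]|]; rewrite addr_ge0 ?(sqr_ge0, exprn_ge0).
Qed.

(** After symmetrisation the pointwise moment bound leaves only the masses of the Gaussians at times
    s and 2 s, both equal to 1. *)
Lemma gk_even_moment N (s x : R) : 0 < s ->
  (\int[mu]_y (gk s (x - y) * (y ^+ 2) ^+ N.+1)%:E <= (Qgk N s x)%:E)%E.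
Proof.
move=> s0.
have mid : measurable_fun [set: R] (@idfun R) by exact: measurable_id.
have mg := measurable_gkr s; have mg2 := measurable_gkr (2 * s).
rewrite gk_conv_sym; last 2 first.
- by apply: measurable_funX; exact: measurable_funX.
- by move=> y; rewrite exprn_ge0// sqr_ge0.
have [B BE] : exists B, B = (N.*2.+2%:R ^+ 2 * 2 ^+ N.*2) * (1 + (x ^+ 2) ^+ N) by eexists.
have B0 : 0 <= B by rewrite BE mulr_ge0 ?(sqr_ge0, exprn_ge0, mulr_ge0, addr_ge0).
have [M ME] : exists M, M = 2 * N.+1`!%:R * 8 ^+ N.+1 * s ^+ N.+1 by eexists.
have M0 : 0 <= M by rewrite ME !mulr_ge0 ?exprn_ge0// ltW.
have pw z : gk s z * ((((x - z) ^+ 2) ^+ N.+1 + ((x + z) ^+ 2) ^+ N.+1) / 2) <=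
    ((x ^+ 2) ^+ N.+1 + B) * gk s z + B * M * gk (2 * s) z.
  have h := even_power_average x z N; rewrite -BE in h.
  apply: le_trans (ler_wpM2l (gk_ge0 s z) h) _.
  have h2 := @gk_moment_pointwise N.+1 s z s0; rewrite -ME in h2.
  move: (gk s z) (gk (2 * s) z) ((z ^+ 2) ^+ N.+1) ((x ^+ 2) ^+ N.+1) h2 {h} => g g' Z X h2.
  have := ler_wpM2l B0 h2; lra.
have s20 : 0 < 2 * s by rewrite mulr_gt0.
move: (gk (2 * s)) mg2 (gk_ge0 (2 * s)) (integral_gk0 s20) pw => g mg2 g0 ig pw.
apply: (@le_trans _ _ (\int[mu]_z (((x ^+ 2) ^+ N.+1 + B)%:E * (gk s z)%:E +
    (B * M)%:E * (g z)%:E))%E).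
  apply: ge0_le_integral_nomeas => z _.
    rewrite lee_fin mulr_ge0 ?gk_ge0// divr_ge0// addr_ge0// exprn_ge0// sqr_ge0//.
  rewrite -!EFinM -EFinD lee_fin; exact: pw.
rewrite ge0_integralD//; last 4 first.
- move=> z _; rewrite -EFinM lee_fin mulr_ge0 ?gk_ge0// addr_ge0// exprn_ge0// sqr_ge0//.
- by apply/measurable_EFinP; exact: measurable_funM.
- by move=> z _; rewrite -EFinM lee_fin mulr_ge0// mulr_ge0.
- by apply/measurable_EFinP; exact: measurable_funM.
rewrite !ge0_integralZl_EFin//; last 6 first.
- by move=> z _; rewrite lee_fin.
- exact/measurable_EFinP.
- by rewrite mulr_ge0.
- by move=> z _; rewrite lee_fin gk_ge0.
- exact/measurable_EFinP.
- by rewrite addr_ge0// exprn_ge0// sqr_ge0.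
rewrite integral_gk0// ig !mule1 -EFinD lee_fin /Qgk /CQ (gtr0_norm s0).
rewrite -addrA lerD2l.
have -> : forall a b : R, N.*2.+2%:R ^+ 2 * 2 ^+ N.*2 * a * (1 + (x ^+ 2) ^+ N) * b = B * (a * b).
  by move=> a b; rewrite BE; ring.
rewrite -[X in X + _]mulr1 -mulrDr ler_wpM2l// ME.
have : 0 <= s ^+ N.+1 by rewrite exprn_ge0// ltW.
have : 0 <= 2 * N.+1`!%:R * 8 ^+ N.+1 :> R by rewrite !mulr_ge0 ?exprn_ge0.
nra.
Qed.

End moments.

(** * Iterated integrals of Gaussian mixtures *)

Lemma eqW d (T : porderType d) (x y : T) : x = y -> (x <= y)%O.
Proof. by move=> ->. Qed.

Section weights.
Variable R : realType.
Local Notation mu := (@lebesgue_measure R).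

(** Densities in the subordination variable s. They vanish for s <= 0, where [gk s] is not a
    probability density. *)
Definition weight (w : R -> R) := [/\ measurable_fun setT w, (forall s, 0 <= w s) &
  forall s, s <= 0 -> w s = 0].

Definition rate (s : R) : R := (4 * pi * s) `^ (- (2^-1)).

(* Fast decay at [s = 0], so that every layer of an iterated integral of the
   corresponding kernel is finite. *)
Definition good_weight M (w : R -> R) := weight w /\
  forall j, (\int[mu]_s (w s * (1 + `|s| ^+ M) * rate s ^+ j)%:E < +oo)%E.

Lemma weight_gk w x : weight w -> weight (fun s => w s * gk s x).
Proof.
move=> [mw w0 wn]; split.
- by apply: measurable_funM => //; exact: measurable_gk2.
- by move=> s; rewrite mulr_ge0 ?gk_ge0.
- by move=> s /wn ->; rewrite mul0r.
Qed.

(** Fixing one coordinate multiplies the weight by a Gaussian of size at most [rate s]. Stability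
    under this operation is why all powers j are demanded. *)
Lemma good_weight_gk M w x : good_weight M w -> good_weight M (fun s => w s * gk s x).
Proof.
move=> [ww fin]; split; first exact: weight_gk.
move=> j; apply: le_lt_trans (fin j.+1); case: ww => mw w0 wn.
have r0 s : 0 <= rate s by exact: powR_ge0.
have s0 s : 0 <= 1 + `|s| ^+ M by rewrite addr_ge0// exprn_ge0.
apply: ge0_le_integral_nomeas => s _; rewrite lee_fin.
  by rewrite ?(gk_ge0, r0, s0, w0, exprn_ge0, mulr_ge0).
have -> : w s * gk s x * (1 + `|s| ^+ M) * rate s ^+ j =
  (w s * (1 + `|s| ^+ M) * rate s ^+ j) * gk s x by ring.
have -> : w s * (1 + `|s| ^+ M) * rate s ^+ j.+1 =
  (w s * (1 + `|s| ^+ M) * rate s ^+ j) * rate s by rewrite exprS; ring.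
by rewrite ler_wpM2l ?gk_le_rate// ?(r0, s0, w0, exprn_ge0, mulr_ge0).
Qed.

Lemma good_weight_fin M w : good_weight M w ->
  (\int[mu]_s (w s * (1 + `|s| ^+ M))%:E < +oo)%E.
Proof.
by move=> [_ /(_ 0%N)]; under eq_integral do rewrite expr0 mulr1.
Qed.

Lemma good_weight_Rint M w : good_weight M w ->
  ((Defs.Rint setT w)%:E = \int[mu]_s (w s)%:E)%E.
Proof.
move=> gw; rewrite /Defs.Rint /Rintegral fineK//; case: (gw) => -[mw w0 wn] _.
rewrite ge0_fin_numE; last by apply: integral_ge0 => s _; rewrite lee_fin.
apply: le_lt_trans (good_weight_fin gw).
apply: ge0_le_integral_nomeas => s _; rewrite lee_fin// ler_peMr//.
by rewrite lerDl exprn_ge0.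
Qed.

Lemma weight_tonelli w x : weight w ->
  (\int[mu]_y \int[mu]_s (w s * gk s (x - y))%:E = \int[mu]_s (w s)%:E)%E.
Proof.
move=> [mw w0 wn]; rewrite (@tonelli_swap _ (fun y s => w s * gk s (x - y))).
- apply: eq_integral => s _; have [s0|s0] := leP s 0.
    rewrite wn//; under eq_integral do rewrite mul0r; rewrite integral0//.
  under eq_integral do rewrite EFinM.
  rewrite ge0_integralZl_EFin ?integral_gk ?mule1//.
    by move=> y _; rewrite lee_fin gk_ge0.
  apply/measurable_EFinP; apply: measurable_gk2 => //.
  exact: measurable_funB.
- apply: measurable_funM; first exact: measurableT_comp.
  apply: measurable_gk2 => //; exact: measurable_funB.
- by move=> y s; rewrite mulr_ge0 ?gk_ge0.
Qed.

(** * Integrating out the coordinates of a Gaussian mixture *)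

Section layers.
Variables (c : R -> R) (Q : R -> R -> R).
Hypothesis mc : measurable_fun setT c.
Hypothesis c_ge0 : forall y, 0 <= c y.
Hypothesis mQ : forall x, measurable_fun setT (Q ^~ x).
Hypothesis Q_ge0 : forall s x, 0 <= Q s x.
Hypothesis cQ : forall s x, 0 < s ->
  (\int[mu]_y (gk s (x - y) * c y)%:E <= (Q s x)%:E)%E.

(** Once the integrals are exchanged, the Gaussian in y has mass 1 against [c0 s] and averages c to
    at most [Q s x]. *)
Lemma layer_tonelli w (c0 : R -> R) (c1 : R) x : weight w ->
  measurable_fun setT c0 -> (forall s, 0 <= c0 s) -> 0 <= c1 ->
  (\int[mu]_y \int[mu]_s (w s * gk s (x - y) * (c0 s + c1 * c y))%:E <=
   \int[mu]_s (w s * (c0 s + c1 * Q s x))%:E)%E.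
Proof.
move=> [mw w0 wn] mc0 c00 c10.
have F0 y s : 0 <= w s * gk s (x - y) * (c0 s + c1 * c y).
  by rewrite ?(gk_ge0, w0, c00, c_ge0, mulr_ge0, addr_ge0).
rewrite (@tonelli_swap _ (fun y s => w s * gk s (x - y) * (c0 s + c1 * c y)))//; last first.
  apply: measurable_funM; first apply: measurable_funM.
  - exact: measurableT_comp.
  - apply: measurable_gk2 => //; exact: measurable_funB.
  apply: measurable_funD; first exact: measurableT_comp.
  by apply: measurable_funM => //; exact: measurableT_comp.
apply: ge0_le_integral_nomeas => s _.
  by apply: integral_ge0 => y _; rewrite lee_fin.
have [s0|s0] := leP s 0.
  rewrite wn// mul0r; under eq_integral do rewrite !mul0r; by rewrite integral0.
have mgx : measurable_fun [set: R] (fun y => gk s (x - y)).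
  by apply: measurable_gk2 => //; exact: measurable_funB.
have -> : (\int[mu]_y (w s * gk s (x - y) * (c0 s + c1 * c y))%:E =
  \int[mu]_y ((w s * c0 s)%:E * (gk s (x - y))%:E +
     (w s * c1)%:E * (gk s (x - y) * c y)%:E))%E.
  by apply: eq_integral => y _; rewrite -!EFinM -EFinD; congr EFin; ring.
rewrite ge0_integralD//; last 4 first.
- by move=> y _; rewrite -EFinM lee_fin ?(gk_ge0, w0, c00, c_ge0, mulr_ge0).
- by apply/measurable_EFinP; exact: measurable_funM.
- by move=> y _; rewrite -EFinM lee_fin ?(gk_ge0, w0, c00, c_ge0, mulr_ge0).
- by apply/measurable_EFinP; apply: measurable_funM => //; exact: measurable_funM.
rewrite !ge0_integralZl_EFin//; last 6 first.
- by move=> y _; rewrite lee_fin mulr_ge0 ?gk_ge0.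
- by apply/measurable_EFinP; exact: measurable_funM.
- by rewrite mulr_ge0.
- by move=> y _; rewrite lee_fin gk_ge0.
- exact/measurable_EFinP.
- by rewrite mulr_ge0.
rewrite integral_gk// mule1.
apply: (@le_trans _ _ ((w s * c0 s)%:E + (w s * c1)%:E * (Q s x)%:E)%E).
  by rewrite leeD2l// lee_wpmul2l ?cQ// lee_fin mulr_ge0.
by rewrite -EFinM -EFinD lee_fin; lra.
Qed.

Lemma sum_row_mx n (F : R -> R) y (x : 'rV[R]_n) :
  \sum_(i < 1 + n) F (row_mx (const_mx y : 'rV[R]_1) x ord0 i) =
  F y + \sum_(i < n) F (x ord0 i).
Proof.
rewrite big_split_ord/= big_ord1 row_mxEl mxE; congr (_ + _).
by apply: eq_bigr => i _; rewrite row_mxEr.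
Qed.

Lemma prod_row_mx n (F : R -> R -> R) x1 y1 (x y : 'rV[R]_n) :
  \prod_(i < 1 + n) F (row_mx (const_mx x1 : 'rV[R]_1) x ord0 i)
                      (row_mx (const_mx y1 : 'rV[R]_1) y ord0 i) =
  F x1 y1 * \prod_(i < n) F (x ord0 i) (y ord0 i).
Proof.
rewrite big_split_ord/= big_ord1 !row_mxEl !mxE; congr (_ * _).
by apply: eq_bigr => i _; rewrite !row_mxEr.
Qed.

Lemma row_mx_eta n (x : 'rV[R]_(1 + n)) :
  x = row_mx (const_mx (x ord0 ord0) : 'rV[R]_1) (rsubmx x).
Proof.
rewrite -[LHS]hsubmxK; congr row_mx; apply/matrixP => i j.
by rewrite !mxE !ord1; congr (x _ _); apply: val_inj.
Qed.

Lemma intRn_ge0 n (f : 'rV[R]_n -> R) : (forall y, 0 <= f y) -> 0 <= intRn f.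
Proof.
elim: n f => [|n IH] f f0 /=; first exact: f0.
by apply: Rintegral_ge0 => y _; exact: IH.
Qed.

(** Domination by a Gaussian mixture centred at x times an additive growth function. The class is
    stable under fixing the first coordinate y: its Gaussian joins w, and [c1 * c y] joins c0. This
    makes induction on the dimension possible. *)
Definition kernel_bound n w (c0 : R -> R) (c1 : R) (x : 'rV[R]_n) (f : 'rV[R]_n -> R) :=
  [/\ weight w, measurable_fun setT c0, (forall s, 0 <= c0 s), 0 <= c1 &
  (forall y, 0 <= f y) /\
  (forall y, ((f y)%:E <= \int[mu]_s (w s * \prod_i gk s (x ord0 i - y ord0 i) *
     (c0 s + c1 * \sum_i c (y ord0 i)))%:E)%E)].

Lemma kernel_bound_row n w (c0 : R -> R) (c1 : R) (x : 'rV[R]_(1 + n)) f y :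
  kernel_bound w c0 c1 x f ->
  kernel_bound (fun s => w s * gk s (x ord0 ord0 - y)) (fun s => c0 s + c1 * c y) c1
    (rsubmx x) (fun z : 'rV[R]_n => f (row_mx (const_mx y : 'rV[R]_1) z)).
Proof.
move=> [ww mc0 c00 c10 [f0 fle]]; split=> //.
- exact: weight_gk.
- exact: measurable_funD.
- by move=> s; rewrite addr_ge0// mulr_ge0.
split=> // z; apply: le_trans (fle _) _; apply/eqW/eq_integral => s _.
rewrite {1}(row_mx_eta x) (@prod_row_mx n (fun a b => gk s (a - b))).
by rewrite sum_row_mx; congr EFin; ring.
Qed.

Definition intRn_upper_at n := forall w (c0 : R -> R) (c1 : R) (x : 'rV[R]_n) f,
  kernel_bound w c0 c1 x f ->
  ((intRn f)%:E <= \int[mu]_s (w s * (c0 s + c1 * \sum_i Q s (x ord0 i)))%:E)%E.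

(** The outermost integral stays in the extended reals, because the lower bounds extract its
    finiteness from here. *)
Lemma intRn_layer_upper n w (c0 : R -> R) (c1 : R) (x : 'rV[R]_(1 + n)) f :
  intRn_upper_at n -> kernel_bound w c0 c1 x f ->
  (\int[mu]_y (intRn (fun z : 'rV[R]_n => f (row_mx (const_mx y : 'rV[R]_1) z)))%:E <=
   \int[mu]_s (w s * (c0 s + c1 * \sum_i Q s (x ord0 i)))%:E)%E.
Proof.
move=> IH kb; have [ww mc0 c00 c10 [f0 fle]] := kb.
have mSQ : measurable_fun setT (fun s => \sum_i Q s (rsubmx x ord0 i)).
  exact: measurable_sum.
have SQ0 s : 0 <= \sum_i Q s (rsubmx x ord0 i) by exact: sumr_ge0.
pose c0' s := c0 s + c1 * \sum_i Q s (rsubmx x ord0 i).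
have mc0' : measurable_fun setT c0' by apply: measurable_funD => //; exact: measurable_funM.
have c0'0 s : 0 <= c0' s by rewrite addr_ge0// mulr_ge0.
apply: (@le_trans _ _ (\int[mu]_y \int[mu]_s
   (w s * gk s (x ord0 ord0 - y) * (c0' s + c1 * c y))%:E)%E).
  apply: ge0_le_integral_nomeas => y _.
    by rewrite lee_fin; exact: intRn_ge0.
  apply: le_trans (IH _ _ _ _ _ (kernel_bound_row y kb)) _.
  by apply/eqW/eq_integral => s _; rewrite /c0'; congr EFin; ring.
apply: le_trans; first exact: layer_tonelli.
apply/eqW/eq_integral => s _; rewrite /c0' {3}(row_mx_eta x) sum_row_mx.
by congr EFin; ring.
Qed.

Lemma intRn_upper n : intRn_upper_at n.
Proof.
elim: n => [|n IH] w c0 c1 x f kb; have [ww mc0 c00 c10 [f0 fle]] := kb.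
  apply: le_trans (fle 0) _; apply/eqW/eq_integral => s _.
  by rewrite !big_ord0 mulr1.
apply: le_trans (@intRn_layer_upper n _ _ _ _ _ IH kb).
by apply: Rintegral_le_integral => y _ //; exact: intRn_ge0.
Qed.

Variable M : nat.
Hypothesis Q_growth : forall x, exists C, forall s, Q s x <= C * (1 + `|s| ^+ M).

Lemma sum_Q_growth n (c0 c1 : R) (x : 'rV[R]_n) : 0 <= c0 -> 0 <= c1 ->
  exists C, 0 <= C /\
  forall s, c0 + c1 * \sum_i Q s (x ord0 i) <= C * (1 + `|s| ^+ M).
Proof.
move=> c00 c10.
have h : exists C, 0 <= C /\ forall s, \sum_i Q s (x ord0 i) <= C * (1 + `|s| ^+ M).
  pose K i := sval (cid (Q_growth (x ord0 i))).
  exists (\sum_i `|K i|); split; first exact: sumr_ge0.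
  move=> s; rewrite mulr_suml; apply: ler_sum => i _.
  have := svalP (cid (Q_growth (x ord0 i))) s; rewrite -/(K i) => h.
  apply: le_trans h _; rewrite ler_wpM2r ?ler_norm// addr_ge0// exprn_ge0//.
have [C [C0 hC]] := h; exists (c0 + c1 * C); split; first by rewrite addr_ge0 ?mulr_ge0.
move=> s; rewrite mulrDl lerD//.
  by rewrite ler_peMr// lerDl exprn_ge0.
by rewrite -mulrA ler_wpM2l.
Qed.

Lemma good_weight_Q_fin n w (c0 c1 : R) (x : 'rV[R]_n) : good_weight M w ->
  0 <= c0 -> 0 <= c1 ->
  (\int[mu]_s (w s * (c0 + c1 * \sum_i Q s (x ord0 i)))%:E < +oo)%E.
Proof.
move=> gw c00 c10; have [C [C0 hC]] := sum_Q_growth x c00 c10.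
have fin := good_weight_fin gw; case: (gw) => -[mw w0 _] _.
apply: (@le_lt_trans _ _ (\int[mu]_s (C%:E * (w s * (1 + `|s| ^+ M))%:E))%E).
  apply: ge0_le_integral_nomeas => s _.
    by rewrite lee_fin mulr_ge0// addr_ge0// mulr_ge0// sumr_ge0.
  rewrite -EFinM lee_fin mulrCA.
  by rewrite ler_wpM2l.
rewrite ge0_integralZl_EFin//.
- by rewrite lte_mul_pinfty// ?fin_numE// lee_fin.
- by move=> s _; rewrite lee_fin mulr_ge0// addr_ge0// exprn_ge0.
- apply/measurable_EFinP; apply: measurable_funM => //.
  by apply: measurable_funD => //; apply: measurable_funX; exact: normr_measurable.
Qed.

(** Each layer is bounded below by the mass of its weight, and these masses integrate to that of w
    by [weight_tonelli]. The upper bound on f enters only to make the layers integrable, so that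
    [Rint] is the true integral. *)
Lemma intRn_lower n w (c0 c1 K : R) (x : 'rV[R]_n) (f : 'rV[R]_n -> R) :
  good_weight M w -> kernel_bound w (fun=> c0) c1 x f -> 0 <= K ->
  (forall y : 'rV[R]_n,
     K * Defs.Rint setT (fun s => w s * \prod_i gk s (x ord0 i - y ord0 i)) <= f y) ->
  K * Defs.Rint setT w <= intRn f.
Proof.
elim: n w c0 c1 K x f => [|n IH] w c0 c1 K x f gw kb K0 lef.
  apply: le_trans (lef 0); under [in leRHS]eq_fun do rewrite big_ord0 mulr1.
  exact: lexx.
have [ww mc0 c00 c10 [f0 fle]] := kb; have [mw w0 wn] := ww.
set x1 := x ord0 ord0.
have lo y : K * Defs.Rint setT (fun s => w s * gk s (x1 - y)) <=
    intRn (fun z : 'rV[R]_n => f (row_mx (const_mx y : 'rV[R]_1) z)).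
  apply: (@IH _ (c0 + c1 * c y) c1 K (rsubmx (x : 'rV_(1 + n)))) => //.
  - exact: good_weight_gk.
  - exact: (@kernel_bound_row n _ _ _ x).
  move=> z; apply: le_trans (lef _); apply/eqW; congr (_ * Defs.Rint _ _).
  apply/funext => s; rewrite {2}(row_mx_eta x) (@prod_row_mx n (fun a b => gk s (a - b))).
  by rewrite mulrA.
have fin : (\int[mu]_y (intRn (fun z : 'rV[R]_n => f (row_mx (const_mx y : 'rV[R]_1) z)))%:E < +oo)%E.
  apply: le_lt_trans (@intRn_layer_upper n _ _ _ _ _ (@intRn_upper n) kb) _.
  exact: (@good_weight_Q_fin (1 + n) w c0 c1 x gw (c00 0) c10).
rewrite -lee_fin EFinM (good_weight_Rint gw) -(weight_tonelli x1 ww).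
have mW : measurable_fun setT (fun y : R => \int[mu]_s (w s * gk s (x1 - y))%:E)%E.
  apply: (@measurable_fun_fubini_tonelli_F _ _ _ _ _ mu
     (fun q : R * R => (w q.2 * gk q.2 (x1 - q.1))%:E)) => /=.
    apply/measurable_EFinP; apply: measurable_funM; first exact: measurableT_comp.
    by apply: measurable_gk2 => //; exact: measurable_funB.
  by move=> q; rewrite lee_fin mulr_ge0 ?gk_ge0.
have W0 y : (0 <= \int[mu]_s (w s * gk s (x1 - y))%:E)%E.
  by apply: integral_ge0 => s _; rewrite lee_fin mulr_ge0 ?gk_ge0.
rewrite -ge0_integralZl_EFin//.
apply: integral_le_Rintegral => [y _|y _|]; last exact: fin.
  by rewrite mule_ge0.
rewrite -(good_weight_Rint (good_weight_gk (x1 - y) gw)) -EFinM lee_fin.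
exact: lo.
Qed.

End layers.
End weights.

(** * The Bessel kernel *)

Section trig.
Variable R : realType.

Lemma sin_bounds (x : R) : 0 <= x <= 1 -> cos 1 * x <= sin x <= x.
Proof.
move=> /andP[x0 x1].
have dsin (y : R) : y \in `]0, x[ -> is_derive y 1 sin (cos y) by move=> _; exact: is_derive_sin.
have csin : {within `[0, x], continuous (@sin R)}.
  by apply: continuous_subspaceT => y; exact: continuous_sin.
have [c /itvP cI] := MVT_segment x0 dsin csin.
rewrite sin0 !subr0 => ->.
have c1 : cos 1 <= cos c.
  have [c1|] := ltP c 1; last by move=> c1; rewrite (_ : c = 1)//; apply/le_anti; rewrite c1 (le_trans _ x1)// cI.
  rewrite ltW// ltr_cos// in_itv/= ?ler01 ?cI/=; last by have := pi_ge2 R; lra.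
  by have := pi_ge2 R; lra.
by rewrite ler_wpM2r//= ler_piMl// cos_le1.
Qed.

Lemma one_minus_cos (x : R) : 1 - cos x = 2 * sin (x / 2) ^+ 2.
Proof.
rewrite {1}(_ : x = (x / 2) *+ 2); last by rewrite -mulr_natr; field.
by rewrite cos_mulr2n sin2cos2 -mulr_natl; ring.
Qed.

Lemma cos_le_quadratic (x : R) : `|x| <= 1 ->
  cos 1 ^+ 2 / 2 * x ^+ 2 <= 1 - cos x <= x ^+ 2 / 2.
Proof.
move=> x1; rewrite -(cos_norm x) one_minus_cos.
have -> : x ^+ 2 = `|x| ^+ 2 by rewrite real_normK// num_real.
have h2 : 0 <= `|x| / 2 <= 1 by have := normr_ge0 x; lra.
have /andP[s1 s2] := sin_bounds h2.
have c0 := @cos1_gt0 R.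
have := normr_ge0 x; set y := `|x| in s1 s2 *; set s := sin _ in s1 s2 *.
move=> y0; have cy : 0 <= cos 1 * y by rewrite mulr_ge0// ltW.
apply/andP; split; last by nra.
have := @lerXn2r R 2 (cos 1 * (y / 2)) s.
rewrite !nnegrE => /(_ _ _ s1); rewrite !exprMn => h.
have : cos 1 ^+ 2 * (y ^+ 2 * 2^-1 ^+ 2) <= s ^+ 2 by apply: h; lra.
lra.
Qed.

Lemma cos_ge_half (x : R) : `|x| <= 1 -> 2^-1 <= cos x.
Proof.
move=> x1; have /andP[_ h] := cos_le_quadratic x1.
have : x ^+ 2 <= 1 by rewrite -(real_normK (num_real x)) expr_le1.
by lra.
Qed.

End trig.

(** * The subordination weight *)

Section bessel_kernel.
Variable R : realType.
Local Notation mu := (@lebesgue_measure R).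

Definition e0 : R -> R := (fun s => expR (- s)) \_ `]0, +oo[.

Lemma e0E s : 0 < s -> e0 s = expR (- s).
Proof. by move=> s0; rewrite /e0 patchE ifT// inE/= in_itv/= s0. Qed.

Lemma e0N s : s <= 0 -> e0 s = 0.
Proof. by move=> s0; rewrite /e0 patchE ifF//; apply/negP; rewrite inE/= in_itv/= andbT ltNge s0. Qed.

Lemma e0_ge0 s : 0 <= e0 s.
Proof. by apply: restrict_ge0 => x _; exact: expR_ge0. Qed.

Lemma weight_e0 : weight e0.
Proof.
split; [|exact: e0_ge0|exact: e0N].
apply/measurable_restrict => //; apply: measurable_funTS.
exact: measurableT_comp.
Qed.

Lemma integral_e0 : (\int[mu]_s (e0 s)%:E = 1)%E.
Proof.
rewrite -(@integral_exponential_pdf R 1)//; apply: ge0_ae_eq_integral => //.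
- by apply/measurable_EFinP; case: weight_e0.
- by apply/measurable_EFinP; exact: measurable_exponential_pdf.
- by move=> s _; rewrite lee_fin e0_ge0.
- by move=> s _; rewrite lee_fin exponential_pdf_ge0.
(* At 0 the exponential density is 1 while [e0] vanishes; elsewhere they agree. *)
exists [set 0]; split => //; first exact: lebesgue_measure_set1.
move=> s /= h; apply: contrapT => /eqP s0; apply: h => _; congr EFin.
have [s1|s1] := leP s 0; last by rewrite e0E// exponential_pdfE ?(ltW s1)// mul1r mulN1r.
by rewrite e0N// lt0_exponential_pdf// lt_neqAle s0.
Qed.

Lemma expRN_poly M (s : R) : 0 < s ->
  expR (- s) * (1 + `|s| ^+ M) <= (1 + M`!%:R * 2 ^+ M) * expR (- (2^-1 * s)).
Proof.
move=> s0; have s0' := ltW s0; rewrite (_ : - s = - (2^-1 * s) + - (2^-1 * s)); last by field.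
rewrite expRD mulrAC ler_wpM2r ?expR_ge0//.
rewrite mulrDr mulr1 lerD//; first by rewrite expR_le1 oppr_le0 mulr_ge0.
rewrite gtr0_norm// expRN mulrC ler_pdivrMr ?expR_gt0//.
have -> : s ^+ M = 2 ^+ M * (2^-1 * s) ^+ M.
  by rewrite -exprMn; congr (_ ^+ _); field.
rewrite [_ * 2 ^+ M]mulrC -mulrA ler_wpM2l ?exprn_ge0//.
by apply: exprn_le_expR; rewrite mulr_ge0.
Qed.

Lemma e0_poly_fin M : (\int[mu]_s (e0 s * (1 + `|s| ^+ M))%:E < +oo)%E.
Proof.
pose C : R := 1 + M`!%:R * 2 ^+ M.
have C0 : 0 <= C by rewrite addr_ge0 ?mulr_ge0 ?exprn_ge0.
apply: (@le_lt_trans _ _ (\int[mu]_s ((C * 2)%:E * (exponential_pdf 2^-1 s)%:E))%E).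
  apply: ge0_le_integral_nomeas => s _.
    by rewrite lee_fin mulr_ge0 ?e0_ge0// addr_ge0// exprn_ge0.
  rewrite -EFinM lee_fin; have [s0|s0] := leP s 0.
    by rewrite e0N// !mul0r mulr_ge0 ?exponential_pdf_ge0 ?invr_ge0// mulr_ge0.
  rewrite e0E// exponential_pdfE ?(ltW s0)//.
  apply: le_trans (expRN_poly M s0) _; rewrite -/C mulNr.
  by rewrite (_ : C * 2 * _ = C * expR (- (2^-1 * s)))//; field.
rewrite ge0_integralZl_EFin ?integral_exponential_pdf ?mule1 ?ltry//.
- by move=> s _; rewrite lee_fin exponential_pdf_ge0.
- by apply/measurable_EFinP; exact: measurable_exponential_pdf.
- by rewrite mulr_ge0.
Qed.

(** Away from the singularity the factor e^{-d^2/(4s)} beats every negative power of s near 0, and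
    e^{-s} beats every polynomial at infinity. *)
Lemma good_weight_e0_gk M (d : R) : d != 0 -> good_weight M (fun s => e0 s * gk s d).
Proof.
move=> d0; split; first exact: weight_gk weight_e0.
move=> j.
have [q qE] : exists q : R, q = d ^+ 2 / 4 by eexists.
have q0 : 0 < q by rewrite qE divr_gt0// exprn_even_gt0.
have q0' := ltW q0.
set A : R := 2 ^+ j.+1 * (1 + j.+1`!%:R * q^-1 ^+ j.+1).
have A0 : 0 <= A by rewrite mulr_ge0 ?exprn_ge0 ?addr_ge0 ?mulr_ge0 ?exprn_ge0 ?invr_ge0.
have rate_exp s : 0 < s -> rate s ^+ j.+1 * expR (- (q * s `^ (-1))) <= A.
  move=> s0; have s0' := ltW s0; rewrite powR_inv1//; set v := s^-1.
  have v0 : 0 < v by rewrite invr_gt0.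
  have v0' := ltW v0.
  have r1 : rate s <= 1 + v.
    rewrite /rate powRN powR12_sqrt ?mulr_ge0 ?pi_ge0//.
    have p0 : 0 < 4 * pi * s by rewrite !mulr_gt0 ?pi_gt0.
    have h : s <= 4 * pi * s by rewrite ler_peMl//; have := pi_ge2 R; lra.
    apply: (@le_trans _ _ (Num.sqrt s)^-1).
      by rewrite lef_pV2 ?posrE ?sqrtr_gt0// ler_wsqrtr.
    rewrite -sqrtrV// -/v -[leRHS]ger0_norm ?addr_ge0//.
    by rewrite -sqrtr_sqr ler_wsqrtr//; nra.
  have r0 : 0 <= rate s by exact: powR_ge0.
  have h1 : rate s ^+ j.+1 <= 2 ^+ j.+1 * (1 + v ^+ j.+1).
    apply: (@le_trans _ _ ((1 + v) ^+ j.+1)).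
      by rewrite lerXn2r ?nnegrE ?addr_ge0.
    have [v1|v1] := leP v 1.
      apply: (@le_trans _ _ (2 ^+ j.+1)).
        by rewrite lerXn2r ?nnegrE ?addr_ge0//; lra.
      by rewrite ler_peMr ?exprn_ge0// lerDl exprn_ge0.
    apply: (@le_trans _ _ ((2 * v) ^+ j.+1)).
      by rewrite lerXn2r ?nnegrE ?addr_ge0 ?mulr_ge0//; lra.
    by rewrite exprMn ler_wpM2l ?exprn_ge0// lerDr.
  apply: le_trans (ler_wpM2r (expR_ge0 _) h1) _; rewrite -mulrA ler_wpM2l ?exprn_ge0//.
  rewrite mulrDl mul1r lerD//.
    by rewrite expR_le1 oppr_le0 mulr_ge0.
  rewrite expRN ler_pdivrMr ?expR_gt0//.
  have -> : v ^+ j.+1 = q^-1 ^+ j.+1 * (q * v) ^+ j.+1.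
    by rewrite -exprMn; congr (_ ^+ _); field; rewrite !gt_eqF.
  rewrite -mulrA [leRHS]mulrCA ler_wpM2l ?exprn_ge0 ?invr_ge0//.
  by apply: exprn_le_expR; rewrite mulr_ge0.
pose C : R := 1 + M`!%:R * 2 ^+ M.
have C0 : 0 <= C by rewrite addr_ge0 ?mulr_ge0 ?exprn_ge0.
apply: (@le_lt_trans _ _ (\int[mu]_s ((A * C * 2)%:E * (exponential_pdf 2^-1 s)%:E))%E).
  apply: ge0_le_integral_nomeas => s _.
    rewrite lee_fin ?(gk_ge0, e0_ge0, powR_ge0, exprn_ge0, mulr_ge0, addr_ge0)//.
  rewrite -EFinM lee_fin; have [s0|s0] := leP s 0.
    rewrite e0N// !mul0r mulr_ge0 ?exponential_pdf_ge0 ?invr_ge0//.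
    by rewrite ?(A0, C0, mulr_ge0).
  rewrite e0E// exponential_pdfE ?(ltW s0)//.
  have -> : expR (- s) * gk s d * (1 + `|s| ^+ M) * rate s ^+ j =
      (rate s ^+ j.+1 * expR (- (q * s `^ (-1)))) * (expR (- s) * (1 + `|s| ^+ M)).
    by rewrite /gk -/(rate s) (exprS (rate s) j) qE; ring.
  have -> : A * C * 2 * (2^-1 * expR (- 2^-1 * s)) = A * (C * expR (- (2^-1 * s))).
    by rewrite mulNr; field.
  apply: ler_pM; [| |exact: rate_exp|exact: expRN_poly].
    by apply: mulr_ge0; rewrite ?expR_ge0// exprn_ge0// powR_ge0.
  by apply: mulr_ge0; rewrite ?expR_ge0// addr_ge0// exprn_ge0.
rewrite ge0_integralZl_EFin ?integral_exponential_pdf ?mule1 ?ltry//.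
- by move=> s _; rewrite lee_fin exponential_pdf_ge0.
- by apply/measurable_EFinP; exact: measurable_exponential_pdf.
- by rewrite ?(A0, C0, mulr_ge0).
Qed.

End bessel_kernel.

(** * Convolution of even polynomials with the Bessel kernel *)

Section bessel_operator.
Variable R : realType.
Local Notation mu := (@lebesgue_measure R).

Lemma enorm_sqr n (x : 'rV[R]_n) : enorm x ^+ 2 = \sum_i x ord0 i ^+ 2.
Proof. by rewrite /enorm sqr_sqrtr// sumr_ge0// => i _; rewrite sqr_ge0. Qed.

Lemma prod_gk n (s : R) (x : 'rV[R]_n) :
  \prod_i gk s (x ord0 i) = rate s ^+ n * expR (- (enorm x ^+ 2 / 4 * s `^ (-1))).
Proof.
rewrite /gk big_split/= prodr_const card_ord; congr (_ * _).
by rewrite -expR_sum enorm_sqr sumrN !mulr_suml.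
Qed.

(** The n-dimensional Gaussian factors over the coordinates, (4 pi s)^{-n/2} being split into n
    square roots. *)
Lemma besselB_gk n (x : 'rV[R]_n) :
  besselB x = Defs.Rint setT (fun s => e0 s * \prod_i gk s (x ord0 i)).
Proof.
rewrite /besselB /Defs.Rint Rintegral_mkcond; congr (Rintegral _ _ _).
apply/funext => s; rewrite /e0 !patchE; case: ifPn => [|_]; last by rewrite mul0r.
rewrite inE/= in_itv/= andbT => s0; rewrite prod_gk mulrA; congr (_ * _ * expR _).
  rewrite (_ : - (n%:R / 2) = - 2^-1 * n%:R); last by field.
  by rewrite powRrM powR_mulrn// powR_ge0.
by rewrite powR_inv1 ?ltW//; field; rewrite gt_eqF.
Qed.

Lemma besselB_ge0 n (x : 'rV[R]_n) : 0 <= besselB x.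
Proof.
apply: Rintegral_ge0 => s _; apply: mulr_ge0; last exact: expR_ge0.
by rewrite mulr_ge0 ?expR_ge0 ?powR_ge0.
Qed.

Lemma opB_ge0 n (phi : 'rV[R]_n -> R) x : (forall y, 0 <= phi y) -> 0 <= opB phi x.
Proof.
by move=> phi0; apply: intRn_ge0 => y; rewrite mulr_ge0 ?besselB_ge0.
Qed.

Definition pow2 N (y : R) := (y ^+ 2) ^+ N.+1.

Lemma pow2_ge0 N y : 0 <= pow2 N y.
Proof. by rewrite /pow2 exprn_ge0 ?sqr_ge0. Qed.

Lemma measurable_pow2 N : measurable_fun setT (pow2 N).
Proof. by apply: measurable_funX; exact: measurable_funX. Qed.

Lemma measurable_Qgk N x : measurable_fun setT (fun s : R => Qgk N s x).
Proof.
apply: measurable_funD => //; apply: measurable_funM => //.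
by apply: measurable_funD => //; apply: measurable_funX; exact: normr_measurable.
Qed.

Lemma Qgk_growth N (x : R) : exists C, forall s, Qgk N s x <= C * (1 + `|s| ^+ N.+1).
Proof.
exists ((x ^+ 2) ^+ N.+1 + CQ R N * (1 + (x ^+ 2) ^+ N)) => s.
rewrite /Qgk mulrDl lerD// ler_peMr//; first exact: (pow2_ge0 N).
by rewrite lerDl exprn_ge0.
Qed.

Lemma besselB_mul_le n N (phi : 'rV[R]_n -> R) (c0 c1 : R) x y :
  (forall y, 0 <= phi y) -> 0 <= c0 -> 0 <= c1 ->
  (forall y, phi y <= c0 + c1 * \sum_i pow2 N (y ord0 i)) ->
  ((besselB (x - y) * phi y)%:E <= \int[mu]_s (e0 s * \prod_i gk s (x ord0 i - y ord0 i) *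
     (c0 + c1 * \sum_i pow2 N (y ord0 i)))%:E)%E.
Proof.
move=> phi0 c00 c10 phile.
have P0 s : 0 <= e0 s * \prod_i gk s (x ord0 i - y ord0 i).
  by rewrite mulr_ge0 ?e0_ge0// prodr_ge0// => i _; exact: gk_ge0.
have S0 : 0 <= c0 + c1 * \sum_i pow2 N (y ord0 i).
  by rewrite addr_ge0// mulr_ge0// sumr_ge0// => i _; exact: pow2_ge0.
have mP : measurable_fun setT (fun s => e0 s * \prod_i gk s (x ord0 i - y ord0 i)).
  apply: measurable_funM; first by case: (@weight_e0 R).
  apply: measurable_prod => i _; exact: measurable_gk2.
under [leRHS]eq_integral do rewrite EFinM.
rewrite ge0_integralZr//; last 2 first.
- exact/measurable_EFinP.
- by move=> s _; rewrite lee_fin; exact: P0.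
rewrite EFinM besselB_gk; apply: lee_pmul; rewrite ?lee_fin//.
- by apply: Rintegral_ge0 => s _; rewrite mulr_ge0 ?e0_ge0// prodr_ge0// => i _; exact: gk_ge0.
- rewrite (_ : (fun s => e0 s * \prod_i gk s ((x - y) ord0 i)) =
      (fun s => e0 s * \prod_i gk s (x ord0 i - y ord0 i))).
    by apply: Rintegral_le_integral => s _.
  by apply/funext => s; congr (_ * _); apply: eq_bigr => i _; rewrite !mxE.
Qed.

Lemma kernel_bound_besselB n N (phi : 'rV[R]_n -> R) (c0 c1 : R) x :
  (forall y, 0 <= phi y) -> 0 <= c0 -> 0 <= c1 ->
  (forall y, phi y <= c0 + c1 * \sum_i pow2 N (y ord0 i)) ->
  kernel_bound (pow2 N) (@e0 R) (fun=> c0) c1 x (fun y => besselB (x - y) * phi y).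
Proof.
move=> phi0 c00 c10 phile; split=> //; first exact: weight_e0.
split=> y; first by rewrite mulr_ge0 ?besselB_ge0.
exact: besselB_mul_le.
Qed.

Definition CB N : R := CQ R N * Defs.Rint setT (fun s => e0 s * (1 + `|s| ^+ N.+1)).

Lemma CB_ge0 N : 0 <= CB N.
Proof.
rewrite mulr_ge0 ?CQ_ge0//; apply: Rintegral_ge0 => s _.
by rewrite mulr_ge0 ?e0_ge0// addr_ge0// exprn_ge0.
Qed.

Lemma integral_e0_Qgk n N (c0 c1 : R) (x : 'rV[R]_n) : 0 <= c0 -> 0 <= c1 ->
  (\int[mu]_s (e0 s * (c0 + c1 * \sum_i Qgk N s (x ord0 i)))%:E =
  (c0 + c1 * \sum_i (pow2 N (x ord0 i) + CB N * (1 + (x ord0 i ^+ 2) ^+ N)))%:E)%E.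
Proof.
move=> c00 c10.
have me0 : measurable_fun setT (@e0 R) by case: (@weight_e0 R).
have mp : measurable_fun setT (fun s : R => e0 s * (1 + `|s| ^+ N.+1)).
  apply: measurable_funM => //.
  by apply: measurable_funD => //; apply: measurable_funX; exact: normr_measurable.
have p0 s : 0 <= e0 s * (1 + `|s| ^+ N.+1).
  by rewrite mulr_ge0 ?e0_ge0// addr_ge0// exprn_ge0.
set A := c0 + c1 * \sum_i pow2 N (x ord0 i).
set B := c1 * (CQ R N * \sum_i (1 + (x ord0 i ^+ 2) ^+ N)).
have A0 : 0 <= A by rewrite addr_ge0// mulr_ge0// sumr_ge0// => i _; exact: pow2_ge0.
have B0 : 0 <= B.
  rewrite mulr_ge0// mulr_ge0 ?CQ_ge0// sumr_ge0// => i _.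
  by rewrite addr_ge0// exprn_ge0 ?sqr_ge0.
transitivity (\int[mu]_s (A%:E * (e0 s)%:E + B%:E * (e0 s * (1 + `|s| ^+ N.+1))%:E))%E.
  apply: eq_integral => s _; rewrite -!EFinM -EFinD; congr EFin.
  have -> : \sum_i Qgk N s (x ord0 i) = \sum_i pow2 N (x ord0 i) +
      CQ R N * (\sum_i (1 + (x ord0 i ^+ 2) ^+ N)) * (1 + `|s| ^+ N.+1).
    by rewrite /Qgk big_split/= -mulr_suml -mulr_sumr.
  by rewrite /A /B; ring.
rewrite ge0_integralD//; last 4 first.
- by move=> s _; rewrite -EFinM lee_fin; apply: mulr_ge0 => //; exact: e0_ge0.
- by apply/measurable_EFinP; exact: measurable_funM.
- by move=> s _; rewrite -EFinM lee_fin; apply: mulr_ge0 => //; exact: p0.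
- by apply/measurable_EFinP; exact: measurable_funM.
rewrite !ge0_integralZl_EFin//; last 4 first.
- by move=> s _; rewrite lee_fin; exact: p0.
- exact/measurable_EFinP.
- by move=> s _; rewrite lee_fin e0_ge0.
- exact/measurable_EFinP.
rewrite integral_e0 mule1.
have <- : ((Defs.Rint setT (fun s => e0 s * (1 + `|s| ^+ N.+1)))%:E =
    \int[mu]_s (e0 s * (1 + `|s| ^+ N.+1))%:E)%E.
  rewrite /Defs.Rint /Rintegral fineK// ge0_fin_numE ?e0_poly_fin//.
  by apply: integral_ge0 => s _; rewrite lee_fin; exact: p0.
rewrite -EFinM -EFinD; congr EFin.
have -> : \sum_i (pow2 N (x ord0 i) + CB N * (1 + (x ord0 i ^+ 2) ^+ N)) =
    \sum_i pow2 N (x ord0 i) + CB N * \sum_i (1 + (x ord0 i ^+ 2) ^+ N).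
  by rewrite [LHS]big_split/= -mulr_sumr.
by rewrite /A /B /CB; ring.
Qed.

(** All upper estimates of the convolution reduce to this one, through a majorant affine in the even
    powers. The correction has degree 2N only. *)
Lemma opB_poly_upper n N (phi : 'rV[R]_n -> R) (c0 c1 : R) x :
  (forall y, 0 <= phi y) -> 0 <= c0 -> 0 <= c1 ->
  (forall y, phi y <= c0 + c1 * \sum_i pow2 N (y ord0 i)) ->
  opB phi x <= c0 + c1 * \sum_i (pow2 N (x ord0 i) + CB N * (1 + (x ord0 i ^+ 2) ^+ N)).
Proof.
move=> phi0 c00 c10 phile; rewrite -lee_fin -(integral_e0_Qgk N x c00 c10).
refine (@intRn_upper _ (pow2 N) (Qgk N) (measurable_pow2 N) (@pow2_ge0 N)
  (measurable_Qgk N) (@Qgk_ge0 _ N) (@gk_even_moment _ N) n (@e0 R) (fun=> c0) c1 x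
  (fun y => besselB (x - y) * phi y) _).
exact: (kernel_bound_besselB x phi0 c00 c10 phile).
Qed.

End bessel_operator.

(** * The cosine as an eigenfunction *)

Section bessel_lower.
Variable R : realType.
Local Notation mu := (@lebesgue_measure R).

Lemma row_mx_head n (y : R) (z : 'rV[R]_n) :
  row_mx (const_mx y : 'rV[R]_1) z ord0 (ord0 : 'I_n.+1) = y.
Proof.
have -> : (ord0 : 'I_n.+1) = lshift n (ord0 : 'I_1) by exact: val_inj.
by rewrite row_mxEl mxE.
Qed.

(** The one-dimensional Bessel kernel. It is also the marginal of the n-dimensional kernel in the
    first coordinate, so it governs functions of x_1 alone in every dimension. *)
Definition bker (z : R) : \bar R := (\int[mu]_s (e0 s * gk s z)%:E)%E.

Lemma bker_ge0 z : (0 <= bker z)%E.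
Proof. by apply: integral_ge0 => s _; rewrite lee_fin; apply: mulr_ge0; [exact: e0_ge0|exact: gk_ge0]. Qed.

Lemma bkerN z : bker (- z) = bker z.
Proof. by apply: eq_integral => s _; rewrite gkN. Qed.

Lemma measurable_bker : measurable_fun setT bker.
Proof.
apply: (@measurable_fun_fubini_tonelli_F _ _ _ _ _ mu
  (fun q : R * R => (e0 q.2 * gk q.2 q.1)%:E)) => /=.
  apply/measurable_EFinP; apply: measurable_funM.
    by apply: measurableT_comp => //; case: (@weight_e0 R).
  exact: measurable_gk2.
by move=> q; rewrite lee_fin mulr_ge0 ?e0_ge0 ?gk_ge0.
Qed.

Lemma integral_bker x : (\int[mu]_y bker (x - y)%R = 1)%E.
Proof. by rewrite -(@integral_e0 R) -(weight_tonelli x (@weight_e0 R)). Qed.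

Lemma integral_bker0 : (\int[mu]_y bker y = 1)%E.
Proof.
rewrite -(integral_bker 0); apply: eq_integral => y _.
by rewrite sub0r bkerN.
Qed.

Lemma measurable_mul_bker (h : R -> R) : measurable_fun setT h ->
  measurable_fun setT (fun z => (h z)%:E * bker z)%E.
Proof.
by move=> mh; apply: emeasurable_funM; [exact/measurable_EFinP|exact: measurable_bker].
Qed.

Lemma integral_bkerD (f g : R -> R) : measurable_fun setT f -> measurable_fun setT g ->
  (forall z, 0 <= f z) -> (forall z, 0 <= g z) ->
  (\int[mu]_z ((f z + g z)%:E * bker z) =
   \int[mu]_z ((f z)%:E * bker z) + \int[mu]_z ((g z)%:E * bker z))%E.
Proof.
move=> mf mg f0 g0; rewrite -ge0_integralD//.
- by apply: eq_integral => z _; rewrite EFinD ge0_muleDl ?lee_fin.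
- by move=> z _; rewrite mule_ge0 ?lee_fin ?bker_ge0.
- exact: measurable_mul_bker.
- by move=> z _; rewrite mule_ge0 ?lee_fin ?bker_ge0.
- exact: measurable_mul_bker.
Qed.

Lemma integral_bkerZ (r : R) (f : R -> R) : measurable_fun setT f -> 0 <= r ->
  (forall z, 0 <= f z) ->
  (\int[mu]_z ((r * f z)%:E * bker z) = r%:E * \int[mu]_z ((f z)%:E * bker z))%E.
Proof.
move=> mf r0 f0; rewrite -ge0_integralZl_EFin//.
- by apply: eq_integral => z _; rewrite EFinM muleA.
- by move=> z _; rewrite mule_ge0 ?lee_fin ?bker_ge0.
- exact: measurable_mul_bker.
Qed.

Lemma integral_bker_cst (r : R) : 0 <= r -> (\int[mu]_z (r%:E * bker z) = r%:E)%E.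
Proof.
move=> r0; rewrite ge0_integralZl_EFin ?integral_bker0 ?mule1//.
- by move=> z _; exact: bker_ge0.
- exact: measurable_bker.
Qed.

Lemma measurable_cosM (k : R) : measurable_fun setT (fun z : R => cos (k * z)).
Proof.
apply: continuous_measurable_fun => z.
apply: continuous_comp; first exact: mulrl_continuous.
exact: continuous_cos.
Qed.

(* [1 - Dcos k] is the eigenvalue of the convolution with the one-dimensional
   Bessel kernel at [cos (k z)]. *)
Definition Dcos (k : R) : R := fine (\int[mu]_z ((1 - cos (k * z))%:E * bker z))%E.

Lemma DcosE k : (\int[mu]_z ((1 - cos (k * z))%:E * bker z) = (Dcos k)%:E)%E.
Proof.
have c0 z : 0 <= 1 - cos (k * z) by rewrite subr_ge0 cos_le1.
rewrite /Dcos fineK// ge0_fin_numE; last first.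
  by apply: integral_ge0 => z _; rewrite mule_ge0 ?lee_fin ?bker_ge0.
apply: (@le_lt_trans _ _ (\int[mu]_z (2%:E * bker z))%E); last first.
  by rewrite integral_bker_cst ?ltry.
apply: ge0_le_integral_nomeas => z _; first by rewrite mule_ge0 ?lee_fin ?bker_ge0.
rewrite lee_wpmul2r ?bker_ge0// lee_fin.
by have := cos_geN1 (k * z); lra.
Qed.

(** Symmetrisation turns cos (k y) into cos (k x) cos (k z). The added 1 keeps the integrand
    nonnegative, as the extended integrals require. *)
Lemma cos_conv_bker k x :
  (\int[mu]_y ((1 + cos (k * y))%:E * bker (x - y)%R) =
   (1 + cos (k * x) - cos (k * x) * Dcos k)%:E)%E.
Proof.
have mcos := measurable_cosM k.
have cosb (y : R) : -1 <= cos y <= 1 by rewrite cos_geN1 cos_le1.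
rewrite (@even_conv_sym _ bker x (fun y => 1 + cos (k * y))); last 5 first.
- exact: measurable_bker.
- exact: bker_ge0.
- exact: bkerN.
- exact: measurable_funD.
- by move=> y; have := cosb (k * y); lra.
set q := cos (k * x); have qb := cosb (k * x); rewrite -/q in qb.
have cb z : -1 <= cos (k * z) <= 1 := cosb (k * z).
have md : measurable_fun setT (fun z : R => 1 - cos (k * z)) by exact: measurable_funB.
have d0 z : 0 <= 1 - cos (k * z) by have := cb z; lra.
under eq_integral => z _.
  rewrite (_ : _ / 2 = 1 + q * cos (k * z)); last first.
    by rewrite mulrBr mulrDr cosB cosD -/q; field.
  over.
have mq : measurable_fun setT (fun z : R => 1 + q * cos (k * z)).
  by apply: measurable_funD => //; exact: measurable_funM.
have q0' z : 0 <= 1 + q * cos (k * z).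
  by have := cb z; nra.
(* Since 1 + q = (1 + q cos (k z)) + q (1 - cos (k z)), the sign of q decides on which side the last
   term is nonnegative. *)
have [q0|q0] := leP 0 q.
  have : (\int[mu]_z ((1 + q)%:E * bker z) = (1 + q)%:E)%E.
    by rewrite integral_bker_cst//; lra.
  have -> : (\int[mu]_z ((1 + q)%:E * bker z) =
     \int[mu]_z (((1 + q * cos (k * z)) + q * (1 - cos (k * z)))%:E * bker z))%E.
    by apply: eq_integral => z _; congr (_%:E * _)%E; ring.
  rewrite integral_bkerD//; last 2 first.
  - exact: measurable_funM.
  - by move=> z; rewrite mulr_ge0.
  rewrite integral_bkerZ// DcosE -EFinM.
  case: (integral _ _ _) => [r| |]//.
  by rewrite -EFinD => -[h]; congr EFin; lra.
transitivity (\int[mu]_z (((1 + q) + (- q) * (1 - cos (k * z)))%:E * bker z))%E.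
  by apply: eq_integral => z _; congr (_%:E * _)%E; ring.
rewrite integral_bkerD//; last 3 first.
- exact: measurable_funM.
- by move=> _; lra.
- by move=> z; rewrite mulr_ge0//; lra.
rewrite integral_bker_cst; last by lra.
rewrite integral_bkerZ//; last by lra.
by rewrite DcosE -EFinM -EFinD; congr EFin; ring.
Qed.

Lemma bker_lower : exists b : R, 0 < b /\
  forall z, 2^-1 <= z <= 1 -> (b%:E <= bker z)%E.
Proof.
pose b : R := expR (- 2) * ((4 * pi * 2) `^ (- (2^-1)) * expR (- (4^-1))).
have b0 : 0 < b by rewrite !mulr_gt0 ?expR_gt0// powR_gt0// !mulr_gt0 ?pi_gt0.
exists b; split => // z /andP[z1 z2].
apply: (@le_trans _ _ (\int[mu]_(s in `[1%R, 2%R]) b%:E)%E).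
  rewrite integral_cst//= lebesgue_measure_itv/= lte_fin ltr1n -EFinB.
  by rewrite (_ : 2 - 1 = 1) ?mule1//; ring.
rewrite integral_mkcond; apply: ge0_le_integral_nomeas => s _.
  by rewrite erestrict_ge0// => ? _; rewrite lee_fin ltW.
rewrite patchE; case: ifPn => [|_]; last first.
  by rewrite lee_fin; apply: mulr_ge0; [exact: e0_ge0|exact: gk_ge0].
rewrite inE/= in_itv/= => /andP[s1 s2].
have s0 : 0 < s by lra.
rewrite lee_fin e0E// /gk; apply: ler_pM; rewrite ?expR_ge0//.
- by rewrite mulr_ge0 ?powR_ge0 ?expR_ge0.
- by rewrite ler_expR; lra.
apply: ler_pM; rewrite ?powR_ge0 ?expR_ge0//.
  have p0 := pi_gt0 R.
  rewrite !powRN lef_pV2 ?posrE ?powR_gt0 ?mulr_gt0//.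
  by apply: ge0_ler_powR; rewrite ?nnegrE ?invr_ge0//; nra.
rewrite ler_expR lerN2 powR_inv1 ?(ltW s0)// ler_pdivrMr//.
have : z ^+ 2 <= 1 by rewrite expr_le1//; lra.
lra.
Qed.

(** The exact value is k^2/(1 + k^2), but a bound suffices: on 1/2 <= z <= 1 the kernel is bounded
    below and 1 - cos (k z) is of order k^2. *)
Lemma Dcos_lower : exists c : R, 0 < c /\ forall k, 0 <= k <= 1 -> c * k ^+ 2 <= Dcos k.
Proof.
have [b [b0 hb]] := bker_lower.
have c1 := @cos1_gt0 R.
pose c : R := cos 1 ^+ 2 / 2 * (2^-1) ^+ 2 * b * 2^-1.
have c0 : 0 < c by rewrite !mulr_gt0 ?exprn_gt0 ?invr_gt0.
exists c; split => // k /andP[k0 k1].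
rewrite -lee_fin -DcosE.
have d0 z : 0 <= 1 - cos (k * z) by rewrite subr_ge0 cos_le1.
set r := cos 1 ^+ 2 / 2 * (2^-1) ^+ 2 * k ^+ 2 * b.
have r0 : 0 <= r by rewrite ?(sqr_ge0, mulr_ge0, divr_ge0, ltW b0).
apply: (@le_trans _ _ (\int[mu]_(s in `[(2^-1)%R, 1%R]) r%:E)%E).
  rewrite integral_cst//= lebesgue_measure_itv/= lte_fin ifT; last by lra.
  by rewrite -EFinB -EFinM lee_fin /r /c; lra.
rewrite integral_mkcond; apply: ge0_le_integral_nomeas => z _.
  by rewrite erestrict_ge0// => ? _; rewrite lee_fin.
rewrite patchE; case: ifPn => [|_]; last by rewrite mule_ge0 ?lee_fin ?bker_ge0.
rewrite inE/= in_itv/= => zI; have /andP[z1 z2] := zI.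
rewrite /r EFinM; apply: lee_pmul; rewrite ?lee_fin ?(ltW b0)//.
- by rewrite ?(sqr_ge0, mulr_ge0, divr_ge0).
- have kz : `|k * z| <= 1 by rewrite ger0_norm ?mulr_ge0; nra.
  have /andP[h _] := cos_le_quadratic kz; apply: le_trans h.
  rewrite exprMn -mulrA ler_wpM2l//; first by rewrite ?(sqr_ge0, divr_ge0).
  rewrite mulrC ler_wpM2l ?sqr_ge0//.
  by rewrite lerXn2r ?nnegrE//; lra.
- exact: hb.
Qed.

(** Integrating out all coordinates but the first leaves [bker], for which the cosine is an
    eigenfunction. The polynomial majorant of phi supplies the finiteness needed for a lower
    bound. *)
Lemma opB_cos_lower n N (phi : 'rV[R]_n.+1 -> R) (c0 c1 C1 C2 k : R) (x : 'rV[R]_n.+1) :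
  (forall y, 0 <= phi y) -> 0 <= c0 -> 0 <= c1 ->
  (forall y, phi y <= c0 + c1 * \sum_i pow2 N (y ord0 i)) ->
  0 <= C2 -> (forall y : 'rV[R]_n.+1, C1 - C2 * cos (k * y ord0 ord0) <= phi y) ->
  C1 - C2 * ((1 - Dcos k) * cos (k * x ord0 ord0)) <= opB phi x.
Proof.
move=> phi0 c00 c10 phile C20 lephi.
have kb := kernel_bound_besselB x phi0 c00 c10 phile.
set x1 := x ord0 ord0.
pose G (y : R) := intRn (fun z : 'rV[R]_n => besselB (x - row_mx (const_mx y : 'rV[R]_1) z) *
   phi (row_mx (const_mx y : 'rV[R]_1) z)).
have fin : (\int[mu]_y (G y)%:E < +oo)%E.
  apply: le_lt_trans.
    apply: (@intRn_layer_upper _ (pow2 N) (Qgk N) (measurable_pow2 N) (@pow2_ge0 R N)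
      (measurable_Qgk N) (@Qgk_ge0 _ N) (@gk_even_moment _ N) n _ _ _ _ _ _ kb).
    exact: (@intRn_upper _ (pow2 N) (Qgk N) (measurable_pow2 N) (@pow2_ge0 R N)
      (measurable_Qgk N) (@Qgk_ge0 _ N) (@gk_even_moment _ N) n).
  by rewrite (@integral_e0_Qgk _ (1 + n) N c0 c1 x)// ltry.
(* The minorant may be negative; as phi is nonnegative, its positive part is a minorant too. *)
pose cp y := Num.max (C1 - C2 * cos (k * y)) 0.
have cp0 y : 0 <= cp y by rewrite /cp le_max lexx orbT.
have mcos := measurable_cosM k.
have mcp : measurable_fun setT cp.
  by apply: measurable_maxr => //; apply: measurable_funB => //; exact: measurable_funM.
have mbx : measurable_fun setT (fun y : R => bker (x1 - y)).
  apply: (measurableT_comp measurable_bker); exact: measurable_funB.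
have bx0 y : (0 <= bker (x1 - y))%E by exact: bker_ge0.
(* At y = x1 the weight [e0 s * gk s 0] need not be good, but a single point does not affect the
   outer integral. *)
have lo y : y != x1 -> ((cp y)%:E * bker (x1 - y) <= (G y)%:E)%E.
  move=> yx; have d0 : x1 - y != 0 by rewrite subr_eq0 eq_sym.
  have gw := @good_weight_e0_gk R N.+1 _ d0.
  have bE : (Defs.Rint setT (fun s => e0 s * gk s (x1 - y)))%:E = bker (x1 - y) :=
    good_weight_Rint gw.
  rewrite -bE -EFinM lee_fin.
  apply: (@intRn_lower _ (pow2 N) (Qgk N) (measurable_pow2 N) (@pow2_ge0 R N)
      (measurable_Qgk N) (@Qgk_ge0 _ N) (@gk_even_moment _ N) N.+1 (@Qgk_growth R N) n _
      (c0 + c1 * pow2 N y) c1 (cp y) (rsubmx (x : 'rV_(1 + n)))) => //.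
    exact: (@kernel_bound_row _ (pow2 N) (@pow2_ge0 R N) n _ _ _ x _ y kb).
  move=> z; rewrite besselB_gk [leRHS]mulrC.
  have -> : (fun s => e0 s * gk s (x1 - y) * \prod_i gk s (rsubmx (x : 'rV_(1 + n)) ord0 i - z ord0 i)) =
      (fun s => e0 s * \prod_(i < 1 + n) gk s ((x - row_mx (const_mx y : 'rV[R]_1) z) ord0 i)).
    apply/funext => s; rewrite -mulrA; congr (_ * _).
    under [RHS]eq_bigr do rewrite mxE (mxE _ _ ord0).
    by rewrite [in RHS](row_mx_eta x) (@prod_row_mx R n (fun a b => gk s (a - b))).
  rewrite ler_wpM2r//.
    apply: Rintegral_ge0 => s _; rewrite mulr_ge0 ?e0_ge0// prodr_ge0// => i _.
    exact: gk_ge0.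
  rewrite /cp ge_max phi0 andbT; apply: le_trans (lephi _).
  by rewrite (@row_mx_head n y z).
have low : (\int[mu]_y ((cp y)%:E * bker (x1 - y)%R) <= (opB phi x)%:E)%E.
  rewrite (_ : integral _ _ _ = \int[mu]_y
      ((((fun y => (cp y)%:E * bker (x1 - y)%R) \_ (setT `\ x1)) y)))%E; last first.
    rewrite -integral_mkcond integral_setD1//; first exact: measurableD.
    by apply: measurable_funTS; apply: emeasurable_funM => //; exact/measurable_EFinP.
  apply: (@integral_le_Rintegral _ _ _ mu setT G) => [y _|y _|]; last exact: fin.
    by apply: erestrict_ge0 => z _; rewrite mule_ge0 ?lee_fin.
  rewrite patchE; case: ifPn => [|_]; last first.
    rewrite lee_fin; apply: intRn_ge0 => z; by rewrite mulr_ge0 ?besselB_ge0.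
  by rewrite inE/= => -[_ /eqP]; exact: lo.
have c10' y : 0 <= 1 + cos (k * y) by have := cos_geN1 (k * y); lra.
(* C1 + C2 is the minorant plus C2 (1 + cos), and the convolution of the latter is known exactly;
   this avoids subtracting integrals. *)
have mono : ((Num.max (C1 + C2) 0)%:E <= \int[mu]_y ((cp y)%:E * bker (x1 - y)%R) +
    \int[mu]_y (C2%:E * ((1 + cos (k * y))%:E * bker (x1 - y)%R)))%E.
  have -> : ((Num.max (C1 + C2) 0)%:E =
      \int[mu]_y ((Num.max (C1 + C2) 0)%:E * bker (x1 - y)%R))%E.
    by rewrite ge0_integralZl_EFin ?integral_bker ?mule1// le_max lexx orbT.
  rewrite -ge0_integralD//; last 4 first.
  - by move=> y _; rewrite mule_ge0 ?lee_fin.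
  - by apply: emeasurable_funM => //; exact/measurable_EFinP.
  - by move=> y _; rewrite !mule_ge0 ?lee_fin.
  - apply: emeasurable_funM => //; apply: emeasurable_funM => //.
    by apply/measurable_EFinP; exact: measurable_funD.
  apply: ge0_le_integral_nomeas => y _.
    by rewrite mule_ge0 ?lee_fin// le_max lexx orbT.
  rewrite muleA -EFinM -ge0_muleDl ?lee_fin ?mulr_ge0// -EFinD.
  rewrite lee_wpmul2r// lee_fin ge_max; apply/andP; split; last first.
    by rewrite addr_ge0 ?mulr_ge0.
  have : C1 - C2 * cos (k * y) <= cp y by rewrite /cp le_max lexx.
  lra.
rewrite ge0_integralZl_EFin// in mono; last 2 first.
- by move=> y _; rewrite mule_ge0 ?lee_fin.
- apply: emeasurable_funM => //.
  by apply/measurable_EFinP; exact: measurable_funD.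
rewrite cos_conv_bker -/x1 in mono.
have := le_trans mono (leeD low (lexx _)); rewrite -EFinM -EFinD lee_fin.
have : C1 + C2 <= Num.max (C1 + C2) 0 by rewrite le_max lexx.
set q := cos _; lra.
Qed.

End bessel_lower.

(** * The weights H_L *)

Section weights_HL.
Variable R : realType.

(** With t = ln r, combine e^v >= 1 + v at v = (1 - th) t and at v = -th t with weights th and 1 -
    th; the terms linear in t cancel. *)
Lemma powR_tangent (r th : R) : 0 < r -> 0 <= th <= 1 -> r `^ th <= 1 + th * (r - 1).
Proof.
move=> r0 /andP[th0 th1].
rewrite /powR gt_eqF//; set t := ln r.
have rE : r = expR t by rewrite lnK// posrE.
have h1 := expR_ge1Dx (t - th * t); have h2 := expR_ge1Dx (- (th * t)).
have e0 := expR_gt0 (th * t); set s := expR (th * t) in e0 *.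
have h3 : s * (1 + (t - th * t)) <= r.
  rewrite rE; have -> : expR t = s * expR (t - th * t).
    by rewrite /s -expRD; congr expR; ring.
  by rewrite ler_wpM2l ?(ltW e0).
have h4 : s * (1 - th * t) <= 1.
  by rewrite -[leRHS](expRxMexpNx_1 (th * t)) ler_wpM2l ?(ltW e0).
have := ler_wpM2l th0 h3.
have th1' : 0 <= 1 - th by lra.
have := ler_wpM2l th1' h4.
lra.
Qed.

Variable n : nat.
Implicit Types (x y : 'rV[R]_n) (L : R).

(** L scales like a squared length: for th = a/(2(N+1)), [HL] is comparable to (L + |y|^2)^{a/2}. *)
Definition XL N L y : R := L ^+ N.+1 + \sum_i pow2 N (y ord0 i).
Definition HL N (th : R) L y : R := XL N L y `^ th.

Lemma sum_pow2_ge0 N y : 0 <= \sum_i pow2 N (y ord0 i).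
Proof. by apply: sumr_ge0 => i _; exact: pow2_ge0. Qed.

Lemma XL_ge N L y : 1 <= L -> L ^+ N.+1 <= XL N L y.
Proof. by move=> L1; rewrite lerDl sum_pow2_ge0. Qed.

Lemma XL_geL N L y : 1 <= L -> L <= XL N L y.
Proof. by move=> L1; apply: le_trans (XL_ge N y L1); rewrite ler_eXnr. Qed.

Lemma XL_gt0 N L y : 1 <= L -> 0 < XL N L y.
Proof. by move=> L1; apply: lt_le_trans (XL_geL N y L1); lra. Qed.

Lemma HL_gt0 N th L y : 1 <= L -> 0 < HL N th L y.
Proof. by move=> L1; rewrite powR_gt0// XL_gt0. Qed.

Definition CH N : R := 2 * n%:R * CB R N.

Lemma CH_ge0 N : 0 <= CH N.
Proof. by rewrite ?(CB_ge0, ler0n, mulr_ge0). Qed.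

(** With v = y_i^2, v^N L is at most L^{N+1} or v^{N+1} according to which of v and L is larger, so
    terms of degree 2N gain a factor 1/L. The 2 accounts for the constant 1. *)
Lemma lower_order_XL N L y : 1 <= L ->
  \sum_i (1 + (y ord0 i ^+ 2) ^+ N) <= 2 * n%:R * XL N L y / L.
Proof.
move=> L1; have L0 : 0 < L by lra.
have -> : 2 * n%:R * XL N L y / L = \sum_(i < n) (2 * XL N L y / L).
  by rewrite sumr_const card_ord -[RHS]mulr_natl; ring.
apply: ler_sum => i _; rewrite ler_pdivlMr//.
have h1 := XL_geL N y L1; set v := y ord0 i ^+ 2.
have v0 : 0 <= v by exact: sqr_ge0.
have h2 : v ^+ N * L <= XL N L y.
  apply: (@le_trans _ _ (L ^+ N.+1 + v ^+ N.+1)).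
    have [vL|Lv] := leP v L.
      have h : v ^+ N * L <= L ^+ N.+1.
        by rewrite (exprSr L) ler_wpM2r ?(ltW L0)// lerXn2r ?nnegrE ?(ltW L0).
      by have := exprn_ge0 N.+1 v0; lra.
    have h : v ^+ N * L <= v ^+ N.+1.
      by rewrite (exprSr v) ler_wpM2l ?(ltW Lv)// exprn_ge0.
    by have := exprn_ge0 N.+1 (ltW L0); lra.
  rewrite lerD2l /XL (bigD1 i)//= lerDl sumr_ge0// => j _; exact: pow2_ge0.
lra.
Qed.

Lemma opB_HL_upper N (th D L : R) (phi : 'rV[R]_n -> R) x :
  0 <= th <= 1 -> 1 <= L -> 0 <= D -> (forall y, 0 <= phi y) ->
  (forall y, phi y <= D * HL N th L y) ->
  opB phi x <= D * ((1 + CH N / L) * HL N th L x).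
Proof.
move=> thb L1 D0 phi0 phile; have /andP[th0 th1] := thb.
have L0 : 0 < L by lra.
set X0 := XL N L x; have X00 : 0 < X0 by exact: XL_gt0.
set h := HL N th L x; have h0 : 0 < h by exact: HL_gt0.
(* c0 and c1 are the coefficients of D times the tangent to X -> X^th at X = [XL N L x], seen as
   affine in the sum of even powers. *)
pose c1 := D * (th * h / X0).
pose c0 := D * (h * ((1 - th) + th * L ^+ N.+1 / X0)).
have c10 : 0 <= c1 by rewrite !mulr_ge0 ?invr_ge0 ?(ltW h0) ?(ltW X00).
have c00 : 0 <= c0.
  rewrite !mulr_ge0 ?(ltW h0)// addr_ge0 ?subr_ge0// !mulr_ge0 ?invr_ge0 ?(ltW X00)//.
  by rewrite exprn_ge0 ?(ltW L0).
have tang y : phi y <= c0 + c1 * \sum_i pow2 N (y ord0 i).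
  apply: le_trans (phile y) _.
  have r0 : 0 < XL N L y / X0 by rewrite divr_gt0 ?XL_gt0.
  have := powR_tangent r0 thb.
  have -> : (XL N L y / X0) `^ th = HL N th L y / h.
    rewrite powRM ?invr_ge0 ?(ltW (XL_gt0 _ _ _)) ?(ltW X00)//; congr (_ * _).
    by rewrite -powR_inv1 ?(ltW X00)// -powRrM mulN1r powRN.
  rewrite ler_pdivrMr// => hh; apply: le_trans (ler_wpM2l D0 hh) _.
  rewrite /c0 /c1 /XL le_eqVlt; apply/orP; left; apply/eqP; field.
  by rewrite gt_eqF.
apply: le_trans (opB_poly_upper x phi0 c00 c10 tang) _.
have -> : \sum_i (pow2 N (x ord0 i) + CB R N * (1 + (x ord0 i ^+ 2) ^+ N)) =
    \sum_i pow2 N (x ord0 i) + CB R N * \sum_i (1 + (x ord0 i ^+ 2) ^+ N).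
  by rewrite [LHS]big_split/= -mulr_sumr.
have lo := lower_order_XL N x L1; rewrite -/X0 in lo.
have -> : \sum_i pow2 N (x ord0 i) = X0 - L ^+ N.+1 by rewrite /X0 /XL; ring.
set S := \sum_i _ in lo *.
have -> : c0 + c1 * (X0 - L ^+ N.+1 + CB R N * S) =
    D * (h * (1 + th * (CB R N * S / X0))).
  by rewrite /c0 /c1; field; rewrite gt_eqF.
rewrite ler_wpM2l// mulrC ler_wpM2r ?(ltW h0)// lerD2l.
have B0 := CB_ge0 R N.
have S0 : 0 <= CB R N * S / X0.
  apply: mulr_ge0; last by rewrite invr_ge0 ltW.
  apply: mulr_ge0 => //; apply: sumr_ge0 => i _.
  by rewrite addr_ge0// exprn_ge0// sqr_ge0.
apply: (@le_trans _ _ (CB R N * S / X0)); first by rewrite ler_piMl.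
rewrite ler_pdivrMr//; apply: le_trans (ler_wpM2l B0 lo) _.
by rewrite /CH le_eqVlt; apply/orP; left; apply/eqP; field; rewrite gt_eqF.
Qed.

Lemma enorm_sqr_le N L y : 1 <= L ->
  enorm y ^+ 2 <= n%:R * XL N L y `^ (N.+1%:R^-1).
Proof.
move=> L1; rewrite enorm_sqr.
have -> : n%:R * XL N L y `^ (N.+1%:R^-1) = \sum_(i < n) XL N L y `^ (N.+1%:R^-1).
  by rewrite sumr_const card_ord mulr_natl.
apply: ler_sum => i _.
have -> : y ord0 i ^+ 2 = pow2 N (y ord0 i) `^ (N.+1%:R^-1).
  by rewrite /pow2 -(@powR_mulrn _ (y ord0 i ^+ 2) N.+1) ?sqr_ge0// -powRrM divff ?powRr1 ?sqr_ge0.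
apply: ge0_ler_powR; rewrite ?invr_ge0// ?nnegrE ?pow2_ge0 ?(ltW (XL_gt0 _ _ _))//.
rewrite /XL (bigD1 i)//= addrCA lerDl addr_ge0//.
  by rewrite exprn_ge0//; lra.
by apply: sumr_ge0 => j _; exact: pow2_ge0.
Qed.

Lemma weight_le_HL N (a : R) L y : 1 <= L -> 0 <= a ->
  (1 + enorm y ^+ 2) `^ (a / 2) <=
  (1 + n%:R) `^ (a / 2) * HL N (a / (2 * N.+1%:R)) L y.
Proof.
move=> L1 a0; have X0 := XL_gt0 N y L1.
have -> : HL N (a / (2 * N.+1%:R)) L y = (XL N L y `^ (N.+1%:R^-1)) `^ (a / 2).
  by rewrite /HL -powRrM; congr (_ `^ _); field.
rewrite -powRM ?addr_ge0 ?powR_ge0//.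
apply: ge0_ler_powR; first by rewrite divr_ge0.
- by rewrite nnegrE addr_ge0 ?sqr_ge0.
- by rewrite nnegrE mulr_ge0 ?powR_ge0// addr_ge0.
rewrite mulrDl mul1r lerD ?enorm_sqr_le//.
have X1 : 1 <= XL N L y by exact: le_trans L1 (XL_geL N y L1).
by rewrite -[leLHS](powRr0 (XL N L y)); apply: ler_powR; rewrite ?invr_ge0.
Qed.

(** This fixes the growth rate: with L of order t, the factor L^{a/2} becomes t^{a/2}. *)
Lemma HL_le_weight N (a : R) L y : 1 <= L -> 0 <= a ->
  HL N (a / (2 * N.+1%:R)) L y <=
  (1 + n%:R) `^ (a / (2 * N.+1%:R)) * L `^ (a / 2) * (1 + enorm y ^+ 2) `^ (a / 2).
Proof.
move=> L1 a0; set th := a / _.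
have th0 : 0 <= th by rewrite divr_ge0 ?mulr_ge0.
have L0 : 0 <= L by lra.
have E0 : 0 <= 1 + enorm y ^+ 2 by rewrite addr_ge0 ?sqr_ge0.
have pE z : 0 <= z -> z `^ (a / 2) = (z ^+ N.+1) `^ th.
  by move=> z0; rewrite -powR_mulrn// -powRrM; congr (_ `^ _); rewrite /th; field.
rewrite !pE// -!powRM ?mulr_ge0 ?addr_ge0 ?exprn_ge0//.
apply: ge0_ler_powR => //; rewrite ?nnegrE ?(ltW (XL_gt0 _ _ _))//.
  by rewrite !mulr_ge0 ?addr_ge0 ?exprn_ge0.
have LN : 1 <= L ^+ N.+1 by rewrite exprn_ege1.
have EN : 1 <= (1 + enorm y ^+ 2) ^+ N.+1 by rewrite exprn_ege1// lerDl sqr_ge0.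
have S : \sum_i pow2 N (y ord0 i) <= n%:R * (1 + enorm y ^+ 2) ^+ N.+1.
  have -> : n%:R * (1 + enorm y ^+ 2) ^+ N.+1 = \sum_(i < n) (1 + enorm y ^+ 2) ^+ N.+1.
    by rewrite sumr_const card_ord mulr_natl.
  apply: ler_sum => i _; rewrite /pow2 lerXn2r ?nnegrE ?sqr_ge0//.
  rewrite enorm_sqr (bigD1 i)//= addrCA lerDl addr_ge0// sumr_ge0// => j _.
  exact: sqr_ge0.
rewrite /XL; set Z := (1 + _) ^+ N.+1 in EN S *; set W := L ^+ N.+1 in LN *.
have n0 : 0 <= n%:R :> R by [].
have h1 : n%:R * Z <= n%:R * (W * Z) by rewrite ler_wpM2l// ler_peMl//; lra.
have h2 : W <= W * Z by rewrite ler_peMr//; lra.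
lra.
Qed.

Lemma enorm_ge0 y : 0 <= enorm y.
Proof. exact: sqrtr_ge0. Qed.

(** The critical exponent enters here: a (1 - p) = sigma + 2 q leaves [HL] times XL^{-q/(N+1)}, and
    XL >= L^{N+1} turns that power into L^{-q}. *)
Lemma nonlinear_weight N (a p sigma q th : R) L y : 1 <= L -> 0 <= sigma -> 0 <= q ->
  a * (1 - p) = sigma + 2 * q ->
  th = a / (2 * N.+1%:R) ->
  enorm y `^ sigma * HL N th L y `^ p <=
  n%:R `^ (sigma / 2) * L `^ (- q) * HL N th L y.
Proof.
move=> L1 s0 q0 aE thE; have X0 := XL_gt0 N y L1; have L0 : 0 < L by lra.
set X := XL N L y in X0 *.
have e1 : enorm y `^ sigma <= n%:R `^ (sigma / 2) * X `^ (sigma / (2 * N.+1%:R)).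
  have -> : enorm y `^ sigma = (enorm y ^+ 2) `^ (sigma / 2).
    by rewrite -powR_mulrn ?enorm_ge0// -powRrM; congr (_ `^ _); field.
  have -> : X `^ (sigma / (2 * N.+1%:R)) = (X `^ (N.+1%:R^-1)) `^ (sigma / 2).
    by rewrite -powRrM; congr (_ `^ _); field.
  rewrite -powRM ?powR_ge0//.
  apply: ge0_ler_powR; rewrite ?divr_ge0// ?nnegrE ?sqr_ge0 ?mulr_ge0 ?powR_ge0//.
  exact: enorm_sqr_le.
have e2 : X `^ (- (q / N.+1%:R)) <= L `^ (- q).
  have -> : L `^ (- q) = (L ^+ N.+1) `^ (- (q / N.+1%:R)).
    by rewrite -powR_mulrn ?(ltW L0)// -powRrM; congr (_ `^ _); field.
  have LX : L ^+ N.+1 <= X by exact: XL_ge.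
  have LM : 0 < L ^+ N.+1 by rewrite exprn_gt0.
  rewrite !powRN lef_pV2 ?posrE ?powR_gt0//.
  by apply: ge0_ler_powR; rewrite ?divr_ge0// ?nnegrE ?(ltW X0) ?(ltW LM).
have E : X `^ (sigma / (2 * N.+1%:R)) * HL N th L y `^ p =
    X `^ (- (q / N.+1%:R)) * HL N th L y.
  rewrite /HL -/X -powRrM -!powRD ?(gt_eqF X0) ?implybT//; congr (_ `^ _).
  rewrite thE; have -> : sigma = a * (1 - p) - 2 * q by rewrite aE; ring.
  by field.
apply: le_trans (ler_wpM2r (powR_ge0 _ _) e1) _.
rewrite -[leLHS]mulrA E [leLHS]mulrA.
by apply: ler_wpM2r; [exact: powR_ge0|apply: ler_wpM2l; [exact: powR_ge0|]].
Qed.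

End weights_HL.

(** * Integral equations in time *)

Section time_integrals.
Variable R : realType.
Local Notation mu := (@lebesgue_measure R).
Implicit Types (f g F : R -> R) (t : R).

Lemma within_integrable f t : {within `[0, t], continuous f} ->
  mu.-integrable `[0, t] (EFin \o f).
Proof. by move=> cf; apply: continuous_compact_integrable => //; exact: segment_compact. Qed.

Lemma Rint_FTC f F t : 0 <= t ->
  (forall s, 0 <= s <= t -> is_derive s 1 F (f s)) ->
  {within `[0, t], continuous f} -> Defs.Rint `[0, t] f = F t - F 0.
Proof.
move=> t0 dF cf; move: t0; rewrite le_eqVlt => /predU1P[<-|t0].
  by rewrite set_itv1 /Defs.Rint Rintegral_set1 subrr.
have cF s : 0 <= s <= t -> {for s, continuous F}.
  move=> st; have [d _] := dF s st.
  exact/differentiable_continuous/derivable1_diffP.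
rewrite /Defs.Rint /Rintegral (@continuous_FTC2 _ f F 0 t)//.
- split.
  + move=> s; rewrite in_itv/= => /andP[s0 st].
    by have [] := dF s (introT andP (conj (ltW s0) (ltW st))).
  + apply: cvg_at_right_filter; apply: cF; lra.
  + apply: cvg_at_left_filter; apply: cF; lra.
- move=> s; rewrite in_itv/= => /andP[s0 st]; rewrite derive1E.
  by have [_ ->] := dF s (introT andP (conj (ltW s0) (ltW st))).
Qed.

Lemma Rint_le f g t : {within `[0, t], continuous g} ->
  (forall s, 0 <= s <= t -> 0 <= f s <= g s) ->
  Defs.Rint `[0, t] f <= Defs.Rint `[0, t] g.
Proof.
move=> cg fg; rewrite -lee_fin; have ig := within_integrable cg.
have -> : ((Defs.Rint `[0, t] g)%:E = \int[mu]_(x in `[0%R, t]) (g x)%:E)%E.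
  by rewrite /Defs.Rint /Rintegral fineK//; exact: integrable_fin_num ig.
apply: Rintegral_le_integral => s /=; rewrite in_itv/= => /fg /andP[? ?] //.
Qed.

(** The bound C keeps the integral of f finite, so that [Rint] does not fall back to 0. *)
Lemma Rint_ge f g t (C : R) : {within `[0, t], continuous g} ->
  (forall s, 0 <= s <= t -> [/\ 0 <= f s, g s <= f s & f s <= C]) ->
  Defs.Rint `[0, t] g <= Defs.Rint `[0, t] f.
Proof.
move=> cg fg; rewrite -lee_fin; have ig := within_integrable cg.
have -> : ((Defs.Rint `[0, t] g)%:E = \int[mu]_(x in `[0%R, t]) (g x)%:E)%E.
  by rewrite /Defs.Rint /Rintegral fineK//; exact: integrable_fin_num ig.
(* g may change sign, but f also dominates its positive part. *)
apply: (@le_trans _ _ (\int[mu]_(x in `[0%R, t]) ((EFin \o g)^\+ x))%E).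
  apply: le_integral => //; first exact: integrable_funepos.
  by move=> s _; rewrite funeposE/= le_max lexx.
apply: integral_le_Rintegral.
- by move=> s _; rewrite funeposE le_max lexx orbT.
- move=> s /=; rewrite in_itv/= => /fg[f0 gf _].
  by rewrite funeposE/= ge_max !lee_fin gf f0.
apply: (@le_lt_trans _ _ (\int[mu]_(x in `[0%R, t]) C%:E)%E).
  by apply: ge0_le_integral_nomeas => s /=; rewrite in_itv/= => /fg[f0 gf fC]; rewrite lee_fin.
rewrite integral_cst//= lebesgue_measure_itv/=; case: ifP => _; last by rewrite mule0 ltry.
by rewrite -EFinD -EFinM ltry.
Qed.

(** Time profile of the supersolution. The second term of its derivative, b times [Efun (b - 1)], is
    the margin that pays for the error terms. *)
Definition Efun (b : R) (t : R) : R := expR t * (1 + t) `^ b.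

Lemma Efun_gt0 b t : -1 < t -> 0 < Efun b t.
Proof. by move=> t1; rewrite mulr_gt0 ?expR_gt0// powR_gt0//; lra. Qed.

Lemma is_derive_Efun b t : -1 < t ->
  is_derive t 1 (Efun b) (Efun b t + b * Efun (b - 1) t).
Proof.
move=> t1; have t0 : 0 < 1 + t by lra.
have h1 : is_derive t 1 (fun s : R => 1 + s) 1.
  rewrite (_ : (fun s : R => 1 + s) = cst 1 + id)//.
  by apply: is_derive_eq; rewrite add0r.
have h2 : is_derive t 1 ((fun s => s `^ b) \o (fun s : R => 1 + s)) (b * (1 + t) `^ (b - 1) * 1).
  by apply: is_derive1_comp; exact: is_derive1_powR.
have := @is_deriveM _ _ expR ((fun s => s `^ b) \o (fun s : R => 1 + s)) t 1 _ _
  (is_derive_expR t) h2.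
move=> h; apply: (@is_derive_eq _ _ _ _ _ _ _ _ h).
by rewrite /Efun /= /GRing.scale /=; ring.
Qed.

Lemma Efun_continuous_at b t : -1 < t -> {for t, continuous (Efun b)}.
Proof.
move=> t1; have [d _] := is_derive_Efun b t1.
exact/differentiable_continuous/derivable1_diffP.
Qed.

End time_integrals.

(** * A priori bounds for solutions *)

Section s_solution_facts.
Variables (R : realType) (n : nat) (p a : R) (V : 'rV[R]_n -> R -> R)
  (u0 : 'rV[R]_n -> R) (u : 'rV[R]_n -> R -> R).
Hypothesis sol : s_solution p a V u0 u.
Local Notation mu := (fun t x => expR t * u x t).

Lemma wnorm_set_ub (rho C : R) (phi : 'rV[R]_n -> R) :
  (forall x, `|phi x| <= C * (rho ^+ 2 + enorm x ^+ 2) `^ (a / 2)) -> 0 < rho ->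
  forall z, [set (rho ^+ 2 + enorm x ^+ 2) `^ (- (a / 2)) * `|phi x| | x in [set: 'rV[R]_n]] z ->
  z <= C.
Proof.
move=> hC rho0 z [x _ <-]; have E0 : 0 < rho ^+ 2 + enorm x ^+ 2.
  by rewrite ltr_pwDl ?sqr_ge0 ?exprn_gt0.
by rewrite powRN mulrC ler_pdivrMr ?powR_gt0.
Qed.

Lemma wnorm_le (rho C : R) (phi : 'rV[R]_n -> R) : 0 < rho ->
  (forall x, `|phi x| <= C * (rho ^+ 2 + enorm x ^+ 2) `^ (a / 2)) -> wnorm rho a phi <= C.
Proof.
move=> rho0 hC; apply: ge_sup; first by eexists; exists 0.
exact: (wnorm_set_ub hC rho0).
Qed.

(** The constant C only certifies that the set is bounded; [sup] of an unbounded set is a default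
    value. *)
Lemma le_wnorm (rho C : R) (phi : 'rV[R]_n -> R) x : 0 < rho ->
  (forall x, `|phi x| <= C * (rho ^+ 2 + enorm x ^+ 2) `^ (a / 2)) ->
  `|phi x| <= wnorm rho a phi * (rho ^+ 2 + enorm x ^+ 2) `^ (a / 2).
Proof.
move=> rho0 hC; have E0 : 0 < rho ^+ 2 + enorm x ^+ 2.
  by rewrite ltr_pwDl ?sqr_ge0 ?exprn_gt0.
rewrite -ler_pdivrMr ?powR_gt0// mulrC -powRN.
apply: ub_le_sup; last by exists x.
by exists C; exact: (wnorm_set_ub hC rho0).
Qed.

Lemma sol_init x : u x 0 = u0 x.
Proof.
have [_ [_ [_ /(_ 0 x (lexx 0))]]] := sol.
by rewrite expR0 mul1r set_itv1 /Defs.Rint !Rintegral_set1 !addr0.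
Qed.

Lemma mu_diff_bound s t x : 0 <= s -> 0 <= t ->
  `|mu t x - mu s x| <=
   wnorm 1 a (mu t - mu s) * (1 + enorm x ^+ 2) `^ (a / 2).
Proof.
move=> s0 t0; have [_ [bc _]] := sol.
have [_ [C hC]] := bc t t0; have [_ [C' hC']] := bc s s0.
have := @le_wnorm 1 (C + C') (mu t - mu s) x ltr01.
rewrite expr1n; apply => y.
apply: le_trans (ler_normB _ _) _; rewrite mulrDl; exact: lerD.
Qed.

(* Local boundedness of [t |-> mu t] in the weighted norm follows from its
   continuity by compactness of [0, T]. *)
Lemma mu_bounded T : 0 <= T -> exists C, forall t x, 0 <= t <= T ->
  mu t x <= C * (1 + enorm x ^+ 2) `^ (a / 2).
Proof.
move=> T0; have [u_ge0 [bc [cont _]]] := sol.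
(* Clipping times at 0 makes g continuous on the whole line. *)
pose g (t : R) := wnorm 1 a (mu (Num.max t 0)).
have max0 (t : R) : 0 <= Num.max t 0 by rewrite le_max lexx orbT.
have bnd t : 0 <= t -> exists C, forall x, `|mu t x| <= C * (1 ^+ 2 + enorm x ^+ 2) `^ (a / 2).
  by move=> t0; have [_ [C hC]] := bc t t0; exists C => x; rewrite expr1n; exact: hC.
have gle s t : g t <= g s + wnorm 1 a (mu (Num.max t 0) - mu (Num.max s 0)).
  apply: wnorm_le => // x; rewrite expr1n mulrDl.
  have [C hC] := bnd _ (max0 s); have := @le_wnorm 1 C _ x ltr01 hC; rewrite expr1n => h1.
  have h2 := mu_diff_bound x (max0 s) (max0 t).
  rewrite -[X in `|X|](subrK (mu (Num.max s 0) x)).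
  by apply: le_trans (ler_normD _ _) _; rewrite addrC; exact: lerD.
have gc : continuous g.
  move=> s; apply/cvgrPdist_lt => e e0.
  have [d [d0 hd]] := cont _ (max0 s) e e0.
  near=> t.
  have dt : `|Num.max t 0 - Num.max s 0| < d.
    have : `|s - t| < d by near: t; apply/nbhs_ballP; exists d.
    rewrite distrC !ltr_norml => /andP[h1 h2].
    by rewrite /Num.max; do 2 case: ifPn => ?; apply/andP; split; lra.
  have w1 := hd _ (max0 t) dt.
  have w2 : wnorm 1 a (mu (Num.max s 0) - mu (Num.max t 0)) < e.
    have -> : wnorm 1 a (mu (Num.max s 0) - mu (Num.max t 0)) =
      wnorm 1 a (mu (Num.max t 0) - mu (Num.max s 0)).
      rewrite /wnorm; congr sup; apply/seteqP; split => z [x _ <-]; exists x => //;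
      by rewrite -normrN; congr (_ * `|_|); rewrite /= !fctE /=; lra.
    exact: w1.
  have := gle s t; have := gle t s; rewrite ltr_norml => *; apply/andP; split; lra.
have [c _ hc] := @EVT_max R g 0 T T0 (continuous_subspaceT gc).
exists (g c) => t x /andP[t0 tT].
have tI : t \in `[0, T] by rewrite in_itv/= t0.
have [C hC] := bnd t t0; have := @le_wnorm 1 C _ x ltr01 hC; rewrite expr1n.
have -> : wnorm 1 a (mu t) = g t by rewrite /g max_l.
move=> h; apply: le_trans (ler_norm _) _; apply: le_trans h _.
by rewrite ler_wpM2r ?powR_ge0// hc.
Unshelve. all: end_near. Qed.

End s_solution_facts.

(** * Upper bound *)

Section upper_bound.
Variable R : realType.

(** Compactness bounds zeta on an initial interval; the limit takes over beyond it. *)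
Lemma zeta_growth (zeta : R -> R) (delta : R) : 0 < delta ->
  {within `[0, +oo[, continuous zeta} -> (forall t, 0 <= t -> 0 < zeta t) ->
  (t `^ (- delta) * zeta t) @[t --> +oo] --> 0 ->
  exists C, 0 < C /\ forall t, 0 <= t -> zeta t <= C * (1 + t) `^ delta.
Proof.
move=> d0 cz z0 cvz.
move/cvgrPdist_lt : cvz => /(_ 1 ltr01)[M [_ hM]].
pose M' := Num.max M 0 + 1.
have M'0 : 0 <= M' by rewrite addr_ge0// le_max lexx orbT.
have cz' : {within `[0, M'], continuous zeta}.
  apply: continuous_subspaceW cz => t /=; rewrite !in_itv/= => /andP[-> _] //.
have [c cI hc] := EVT_max M'0 cz'.
have c0 : 0 <= c by move: cI; rewrite in_itv/= => /andP[].
have zc := z0 c c0.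
exists (zeta c + 1); split; first by lra.
move=> t t0.
have E1 : 1 <= (1 + t) `^ delta.
  by rewrite -[leLHS](powRr0 (1 + t)); apply: ler_powR; lra.
have [tM|Mt] := leP t M'.
  have h : zeta t <= zeta c by apply: hc; rewrite in_itv/= t0.
  apply: le_trans h _; have := ler_peMr (ltW zc) E1; lra.
have Mt' : M < t.
  apply: le_lt_trans Mt; rewrite /M'; have : M <= Num.max M 0 by rewrite le_max lexx.
  lra.
have tp : 0 < t by apply: le_lt_trans Mt.
have := hM t Mt'; rewrite sub0r normrN ger0_norm; last first.
  by rewrite mulr_ge0 ?powR_ge0// ltW// z0.
rewrite powRN mulrC ltr_pdivrMr ?powR_gt0// mul1r => /ltW h.
have h2 : t `^ delta <= (1 + t) `^ delta.
  by apply: ge0_ler_powR; rewrite ?nnegrE ?ltW//; lra.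
have : 0 <= zeta c * (1 + t) `^ delta by rewrite mulr_ge0 ?powR_ge0// ltW.
lra.
Qed.

Lemma Efun_homo (b s t : R) : 0 <= b -> 0 <= s -> s <= t -> Efun b s <= Efun b t.
Proof.
move=> b0 s0 st; rewrite /Efun; apply: ler_pM; rewrite ?expR_ge0 ?powR_ge0 ?ler_expR//.
by apply: ge0_ler_powR; rewrite ?nnegrE; lra.
Qed.

Lemma Efun0 (b : R) : Efun b 0 = 1.
Proof. by rewrite /Efun expR0 addr0 powR1 mulr1. Qed.

Lemma EfunB1 (b t : R) : 0 <= t -> Efun (b - 1) t = Efun b t / (1 + t).
Proof.
move=> t0; have t1 : 1 + t != 0 by rewrite gt_eqF//; lra.
rewrite /Efun powRB ?t1 ?implybT//.
by rewrite powRr1 ?mulrA//; lra.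
Qed.

Variables (n N : nat) (p a : R) (V : 'rV[R]_n -> R -> R)
  (u0 : 'rV[R]_n -> R) (u : 'rV[R]_n -> R -> R).
Hypothesis sol : s_solution p a V u0 u.
Hypothesis a_ge0 : 0 <= a.
Let th := a / (2 * N.+1%:R).
Hypothesis th1 : th <= 1.
Local Notation mu := (fun t x => expR t * u x t).
Local Notation H := (HL N th).

Variables (T A L k : R).
Hypothesis T_ge0 : 0 <= T.
Hypothesis A_gt0 : 0 < A.
Hypothesis L_ge1 : 1 <= L.
Hypothesis k_gt0 : 0 < k.
Hypothesis CHL1 : CH R n N / L <= 1.
Hypothesis CHLk : CH R n N / L * (1 + T) <= k / 2.
Hypothesis u0_le : forall x, u0 x <= A * H L x.
Hypothesis V_ge0 : forall y (t : R), 0 <= t -> 0 <= V y t.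
(* Supersolution inequality for the nonlinear term, at all amplitudes [Phi >= 1]. *)
Hypothesis V_le : forall y (t Phi z : R), 0 <= t <= T -> 1 <= Phi -> 0 <= z ->
  z <= Phi * (A * Efun k t * H L y) ->
  expR ((1 - p) * t) * (V y t * z `^ p) <= Phi * (A * (k / 4) * Efun (k - 1) t) * H L y.

Let th0 : 0 <= th.
Proof. by rewrite divr_ge0 ?mulr_ge0. Qed.

(** The gain comes from the datum: it is bounded by A H and not by Phi A H, while the integrals
    reproduce Phi A H ([Efun k t] - 1). What is saved is (Phi - 1) A H, and [Efun k t] <= [Efun k T]
    makes the saving uniform in t. *)
Lemma upper_step (Phi t : R) (x : 'rV[R]_n) : 1 <= Phi -> 0 <= t <= T ->
  (forall (s : R) (y : 'rV[R]_n), 0 <= s <= T -> mu s y <= Phi * (A * Efun k s * H L y)) ->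
  mu t x <= (Phi - (Phi - 1) / Efun k T) * (A * Efun k t * H L x).
Proof.
move=> Phi1 /andP[t0 tT] bnd; have [u_ge0 [_ [_ eqn]]] := sol.
have thb : 0 <= th <= 1 by rewrite th0 th1.
have h0 := HL_gt0 N th x L_ge1; have CH0 := CH_ge0 R n N.
have L0 : 0 < L := lt_le_trans ltr01 L_ge1.
have CL0 : 0 <= CH R n N / L by rewrite divr_ge0// ltW.
set c := Phi * A * H L x.
have Phi0 : 0 < Phi := lt_le_trans ltr01 Phi1.
have c0 : 0 < c by rewrite !mulr_gt0.
have E0 (b s : R) : 0 <= s -> 0 < Efun b s by move=> s0; apply: Efun_gt0; lra.
(* g1 + g2 is the derivative of c times [Efun k]: half of the margin k pays for CH/L <= (k/2)/(1 +
   s), the other half for the source. *)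
pose g1 s := c * (Efun k s + k / 2 * Efun (k - 1) s).
pose g2 s := c * (k / 2 * Efun (k - 1) s).
have cE (b s : R) : 0 <= s -> Efun b v @[v --> s] --> Efun b s.
  by move=> s0; apply: Efun_continuous_at; lra.
have cg2 : {within `[0, t], continuous g2}.
  apply: continuous_in_subspaceT => s; rewrite inE/= in_itv/= => /andP[s0 _].
  by apply: cvgM; [exact: cvg_cst|apply: cvgM; [exact: cvg_cst|exact: cE]].
have cg1 : {within `[0, t], continuous g1}.
  apply: continuous_in_subspaceT => s; rewrite inE/= in_itv/= => /andP[s0 _].
  apply: cvgM; [exact: cvg_cst|apply: cvgD; [exact: cE|]].
  by apply: cvgM; [exact: cvg_cst|exact: cE].
have mu0 s y : 0 <= s -> 0 <= mu s y by move=> s0; rewrite mulr_ge0 ?expR_ge0// u_ge0.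
have i1 : Defs.Rint `[0, t] (fun s => opB (mu s) x) <= Defs.Rint `[0, t] g1.
  apply: Rint_le => // s /andP[s0 st]; apply/andP; split.
    by apply: opB_ge0 => y; exact: mu0.
  have sT : 0 <= s <= T by rewrite s0 (le_trans st).
  have D0 : 0 <= Phi * (A * Efun k s).
    by apply: ltW; apply: mulr_gt0 => //; apply: mulr_gt0 => //; exact: E0.
  apply: le_trans.
    apply: (@opB_HL_upper R n N th (Phi * (A * Efun k s)) L) => //.
    - by move=> y; exact: mu0.
    - by move=> y; rewrite -mulrA; exact: bnd.
  rewrite /g1 EfunB1// (_ : _ * ((1 + _) * _) = c * (Efun k s * (1 + CH R n N / L))); last first.
    by rewrite /c; ring.
  have -> : Efun k s + k / 2 * (Efun k s / (1 + s)) = Efun k s * (1 + k / 2 / (1 + s)).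
    by field; rewrite gt_eqF//; lra.
  rewrite ler_wpM2l ?(ltW c0)//.
  rewrite ler_wpM2l ?(ltW (E0 _ _ s0))// lerD2l ler_pdivlMr; last by lra.
  apply: le_trans CHLk; rewrite ler_wpM2l//; lra.
have i2 : Defs.Rint `[0, t] (fun tau => expR ((1 - p) * tau) *
    opB (fun y => V y tau * mu tau y `^ p) x) <= Defs.Rint `[0, t] g2.
  apply: Rint_le => // s /andP[s0 st].
  have B0 y : 0 <= V y s * mu s y `^ p by rewrite mulr_ge0 ?V_ge0 ?powR_ge0.
  apply/andP; split; first by rewrite mulr_ge0 ?expR_ge0//; exact: opB_ge0.
  have sT : 0 <= s <= T by rewrite s0 (le_trans st).
  set D := Phi * (A * (k / 4) * Efun (k - 1) s) / expR ((1 - p) * s).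
  have D0 : 0 <= D.
    apply: divr_ge0; last exact: expR_ge0.
    apply: ltW; apply: mulr_gt0 => //; apply: mulr_gt0; last exact: E0.
    by apply: mulr_gt0 => //; exact: divr_gt0.
  have VD y : V y s * mu s y `^ p <= D * H L y.
    rewrite /D mulrAC ler_pdivlMr ?expR_gt0// mulrC.
    by apply: V_le => //; [exact: mu0|exact: bnd].
  have hB := @opB_HL_upper R n N th D L _ x thb L_ge1 D0 B0 VD.
  apply: le_trans (ler_wpM2l (expR_ge0 _) hB) _.
  rewrite (_ : expR _ * _ = c * (k / 4 * Efun (k - 1) s * (1 + CH R n N / L))); last first.
    by rewrite /c /D; field; rewrite ?expR_eq0 ?gt_eqF ?expR_gt0.
  rewrite /g2 ler_wpM2l ?(ltW c0)//.
  have e0 := E0 (k - 1) s s0.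
  (* The bound CH/L <= 1 is used here: convolution at most doubles the weight, hence k/4 in the
     assumption on V. *)
  have : k / 4 * Efun (k - 1) s * (1 + CH R n N / L) <= k / 4 * Efun (k - 1) s * 2.
    apply: ler_wpM2l; last by have := CHL1; lra.
    by apply: ltW; apply: mulr_gt0 => //; exact: divr_gt0.
  lra.
have sumE : Defs.Rint `[0, t] g1 + Defs.Rint `[0, t] g2 = c * (Efun k t - 1).
  rewrite /Defs.Rint -RintegralD//; [|exact: within_integrable|exact: within_integrable].
  have -> : c * (Efun k t - 1) = c * Efun k t - c * Efun k 0 by rewrite Efun0; ring.
  rewrite -/(Defs.Rint `[0, t] (fun s => g1 s + g2 s)).
  apply: (@Rint_FTC R (fun s => g1 s + g2 s) (fun s => c * Efun k s) t t0).
    move=> s /andP[s0 _]; have s1 : -1 < s by lra.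
    have h := @is_derive_Efun R k s s1.
    have h' := @is_deriveZ _ _ _ (Efun k) c s 1 _ h.
    apply: (@is_derive_eq _ _ _ _ _ _ _ _ h').
    by rewrite /g1 /g2 /GRing.scale/=; field.
  by move=> s; apply: continuousD; [exact: cg1|exact: cg2].
rewrite (eqn t x t0) -addrA.
apply: le_trans (lerD (u0_le x) (lerD i1 i2)) _.
rewrite sumE /c.
have Et : Efun k t <= Efun k T by apply: Efun_homo => //; exact: ltW.
have ET0 : 0 < Efun k T by exact: E0.
have r1 : Efun k t / Efun k T <= 1 by rewrite ler_pdivrMr// mul1r.
have Phi10 : 0 <= Phi - 1 by lra.
have := ler_wpM2l Phi10 r1.
have AH : 0 <= A * H L x by rewrite mulr_ge0 ?ltW.
move=> hh; have := ler_wpM2l AH hh.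
rewrite (_ : (Phi - (Phi - 1) / Efun k T) * (A * Efun k t * H L x) =
  A * H L x * (Phi * Efun k t) - A * H L x * ((Phi - 1) * (Efun k t / Efun k T))); last first.
  by field; rewrite gt_eqF.
lra.
Qed.

(** The least admissible factor is the supremum of W, finite by [mu_bounded]. If it exceeded 1,
    [upper_step] would produce a strictly smaller admissible factor. *)
Lemma upper_horizon (t : R) (x : 'rV[R]_n) : 0 <= t <= T -> mu t x <= A * Efun k t * H L x.
Proof.
have E0 (s : R) : 0 <= s -> 0 < Efun k s by move=> s0; apply: Efun_gt0; lra.
have den (s : R) (y : 'rV[R]_n) : 0 <= s -> 0 < A * Efun k s * H L y.
  move=> s0; apply: mulr_gt0; last exact: HL_gt0.
  by apply: mulr_gt0 => //; exact: E0.
pose W := [set z | exists s y, 0 <= s <= T /\ z = mu s y / (A * Efun k s * H L y)].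
have [C hC] := mu_bounded sol T_ge0.
have Wub : has_ubound W.
  exists (`|C| * (1 + n%:R) `^ (a / 2) / A) => z [s [y [sT ->]]].
  have /andP[s0 _] := sT.
  have h1 := hC s y sT; have h2 := @weight_le_HL R n N a L y L_ge1 a_ge0.
  rewrite ler_pdivrMr ?den//.
  rewrite (_ : _ / A * _ = `|C| * ((1 + n%:R) `^ (a / 2) * H L y) * Efun k s); last first.
    by field; rewrite gt_eqF.
  have E1 : 1 <= Efun k s by rewrite -(Efun0 k); apply: Efun_homo => //; exact: ltW.
  apply: le_trans h1 _.
  apply: (@le_trans _ _ (`|C| * (1 + enorm y ^+ 2) `^ (a / 2))).
    by rewrite ler_wpM2r ?powR_ge0// ler_norm.
  apply: (@le_trans _ _ (`|C| * ((1 + n%:R) `^ (a / 2) * H L y))).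
    by rewrite ler_wpM2l.
  by rewrite ler_peMr// !mulr_ge0 ?powR_ge0.
have W0 : W !=set0 by eexists; exists 0, 0; split; [rewrite lexx|reflexivity].
have bnd s y : 0 <= s <= T -> mu s y <= sup W * (A * Efun k s * H L y).
  move=> sT; have /andP[s0 _] := sT.
  rewrite -ler_pdivrMr ?den//; apply: ub_le_sup => //; by exists s, y.
have [le1|gt1] := leP (sup W) 1.
  move=> tT; have /andP[s0 _] := tT; apply: le_trans (bnd _ _ tT) _.
  by rewrite ler_piMl// ltW// den.
exfalso.
have : sup W <= sup W - (sup W - 1) / Efun k T.
  apply: ge_sup => // z [s [y [sT ->]]]; have /andP[s0 _] := sT.
  rewrite ler_pdivrMr ?den//; apply: upper_step => //; exact: ltW.
have : 0 < (sup W - 1) / Efun k T by rewrite divr_gt0 ?E0//; lra.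
lra.
Qed.

End upper_bound.

(** * Choice of the supersolution *)

Section upper_estimate.
Variables (R : realType) (n : nat).

(** The growth k (1 - p) allowed for zeta is what balances the powers: k (1 - p) + nu + k p = (k -
    1) + (nu + 1). The factor L^{-q} absorbs (1 + s)^{nu+1}, a large A^{1-p} absorbs the constants,
    and Phi^p <= Phi since Phi >= 1. *)
Lemma nonlinear_supersolution N (p nu sigma a A L T k Cz s Phi z zs : R) (y : 'rV[R]_n) :
  0 < p < 1 -> 0 <= sigma -> a * (1 - p) = sigma + 2 * Num.max (nu + 1) 0 ->
  0 < A -> 0 < k -> 0 <= Cz -> 1 + T <= L -> 0 <= s <= T -> 1 <= Phi -> 0 <= z ->
  zs <= Cz * (1 + s) `^ (k * (1 - p)) ->
  4 * (Cz * n%:R `^ (sigma / 2)) / k <= A `^ (1 - p) ->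
  let H := HL N (a / (2 * N.+1%:R)) L y in
  z <= Phi * (A * Efun k s * H) ->
  expR ((1 - p) * s) * (zs * (1 + s) `^ nu * enorm y `^ sigma * z `^ p) <=
  Phi * (A * (k / 4) * Efun (k - 1) s) * H.
Proof.
move=> /andP[p0 p1] s0 aE A0 k0 Cz0 TL /andP[t0 tT] Phi1 z0 zsle Ale H zle.
set q := Num.max _ _ in aE; set Cs := n%:R `^ _ in Ale.
have q0 : 0 <= q by rewrite /q le_max lexx orbT.
have L1 : 1 <= L by lra.
have H0 : 0 < H by exact: HL_gt0.
have Cs0 : 0 <= Cs by exact: powR_ge0.
have E0 : 0 < Efun k s by apply: Efun_gt0; lra.
have s1 : 0 < 1 + s by lra.
have Phi0 : 0 <= Phi by lra.
have AE0 : 0 <= A * Efun k s by rewrite mulr_ge0 ?(ltW A0) ?(ltW E0).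
have AEH0 : 0 <= A * Efun k s * H by rewrite mulr_ge0 ?(ltW H0).
have zp : z `^ p <= Phi * (A `^ p * Efun k s `^ p * H `^ p).
  apply: (@le_trans _ _ ((Phi * (A * Efun k s * H)) `^ p)).
    apply: ge0_ler_powR => //; [exact: ltW|by rewrite nnegrE; exact: mulr_ge0].
  rewrite powRM// powRM ?(ltW H0)// powRM ?(ltW A0) ?(ltW E0)//.
  rewrite ler_wpM2r//; last exact: ler1_powR (ltW p1).
  by rewrite mulr_ge0 ?powR_ge0// mulr_ge0 ?powR_ge0.
have hw := @nonlinear_weight R n N a p sigma q _ L y L1 s0 q0 aE erefl; rewrite -/H -/Cs in hw.
have h1 : zs * (1 + s) `^ nu * enorm y `^ sigma * z `^ p <=
    Cz * (1 + s) `^ (k * (1 - p)) * (1 + s) `^ nu * (Phi * (A `^ p * Efun k s `^ p)) *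
      (Cs * L `^ (- q) * H).
  apply: (@le_trans _ _ (Cz * (1 + s) `^ (k * (1 - p)) * (1 + s) `^ nu *
      enorm y `^ sigma * (Phi * (A `^ p * Efun k s `^ p * H `^ p)))).
    apply: (@le_trans _ _ (Cz * (1 + s) `^ (k * (1 - p)) * (1 + s) `^ nu *
      enorm y `^ sigma * z `^ p)).
      rewrite ler_wpM2r ?powR_ge0// ler_wpM2r ?powR_ge0//.
      by rewrite ler_wpM2r ?powR_ge0.
    rewrite ler_wpM2l//; do 3 (rewrite mulr_ge0 ?powR_ge0//).
  rewrite (_ : _ * enorm y `^ sigma * _ = Cz * (1 + s) `^ (k * (1 - p)) * (1 + s) `^ nu *
     (Phi * (A `^ p * Efun k s `^ p)) * (enorm y `^ sigma * H `^ p)); last by ring.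
  rewrite ler_wpM2l//.
  apply: mulr_ge0; first by do 2 (rewrite mulr_ge0 ?powR_ge0//).
  by rewrite mulr_ge0// mulr_ge0 ?powR_ge0.
apply: le_trans (ler_wpM2l (expR_ge0 _) h1) _.
have Ep : expR ((1 - p) * s) * Efun k s `^ p = expR s * (1 + s) `^ (k * p).
  rewrite /Efun powRM ?expR_ge0 ?powR_ge0// -expRM -powRrM mulrA -expRD.
  by congr (expR _ * _); ring.
have sE : (1 + s) `^ (k * (1 - p)) * (1 + s) `^ nu * (1 + s) `^ (k * p) =
    (1 + s) `^ (k - 1) * (1 + s) `^ (nu + 1).
  rewrite -!powRD ?(gt_eqF s1) ?implybT//; congr (_ `^ _); ring.
have -> : expR ((1 - p) * s) * (Cz * (1 + s) `^ (k * (1 - p)) * (1 + s) `^ nu *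
    (Phi * (A `^ p * Efun k s `^ p)) * (Cs * L `^ (- q) * H)) =
  Cz * Cs * Phi * A `^ p * L `^ (- q) * H * (expR ((1 - p) * s) * Efun k s `^ p) *
  ((1 + s) `^ (k * (1 - p)) * (1 + s) `^ nu) by ring.
rewrite Ep.
have -> : Cz * Cs * Phi * A `^ p * L `^ (- q) * H * (expR s * (1 + s) `^ (k * p)) *
  ((1 + s) `^ (k * (1 - p)) * (1 + s) `^ nu) =
  Cz * Cs * Phi * A `^ p * L `^ (- q) * H * expR s *
  ((1 + s) `^ (k * (1 - p)) * (1 + s) `^ nu * (1 + s) `^ (k * p)) by ring.
rewrite sE.
(* Both nu + 1 <= q and 1 + s <= 1 + T <= L are used. *)
have Lq : (1 + s) `^ (nu + 1) * L `^ (- q) <= 1.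
  have Lp : 0 < L by lra.
  rewrite powRN ler_pdivrMr ?powR_gt0// mul1r.
  apply: (@le_trans _ _ ((1 + s) `^ q)).
    by apply: ler_powR; rewrite ?/q ?le_max ?lexx//; lra.
  by apply: ge0_ler_powR; rewrite ?nnegrE//; lra.
have AA : A `^ p * A `^ (1 - p) = A.
  rewrite -powRD ?(gt_eqF A0) ?implybT//.
  by rewrite (_ : p + (1 - p) = 1) ?powRr1 ?(ltW A0)//; ring.
set F := Phi * H * expR s * (1 + s) `^ (k - 1).
have F0 : 0 <= F by do 3 (rewrite mulr_ge0 ?powR_ge0 ?expR_ge0 ?(ltW H0)//).
have -> : Phi * (A * (k / 4) * Efun (k - 1) s) * H = F * (A * (k / 4)).
  by rewrite /F /Efun; ring.
have -> : Cz * Cs * Phi * A `^ p * L `^ (- q) * H * expR s *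
   ((1 + s) `^ (k - 1) * (1 + s) `^ (nu + 1)) =
   F * ((A `^ p * (Cz * Cs)) * ((1 + s) `^ (nu + 1) * L `^ (- q))).
  by rewrite /F; ring.
rewrite ler_wpM2l//.
have G0 : 0 <= A `^ p * (Cz * Cs) by rewrite mulr_ge0 ?powR_ge0// mulr_ge0.
apply: (@le_trans _ _ (A `^ p * (Cz * Cs))); first by rewrite ler_piMr.
rewrite -{2}AA -mulrA ler_wpM2l ?powR_ge0//.
move: Ale; rewrite ler_pdivrMr//; lra.
Qed.

Lemma upper_wnorm (p nu sigma rho : R) (zeta : R -> R)
  (u0 : 'rV[R]_n -> R) (u : 'rV[R]_n -> R -> R) (a : R) :
  0 < p < 1 -> 0 <= sigma -> a = (sigma + 2 * Num.max (nu + 1) 0) / (1 - p) ->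
  {within `[0, +oo[, continuous zeta} -> (forall t, 0 <= t -> 0 < zeta t) ->
  (forall delta : R, 0 < delta -> (t `^ (- delta) * zeta t) @[t --> +oo] --> 0) ->
  s_solution p a (fun x t => zeta t * (1 + t) `^ nu * enorm x `^ sigma) u0 u ->
  0 < rho -> forall eps' : R, 0 < eps' -> exists Cu : R, 0 < Cu /\
    forall t, 1 <= t -> wnorm rho a (fun x => u x t) <= Cu * t `^ (a / 2 + eps').
Proof.
move=> p01 s0 aE cz z0 zlim sol rho0 k k0; have /andP[p0 p1] := p01.
have p1' : 0 < 1 - p by lra.
set q := Num.max _ _ in aE.
have q0 : 0 <= q by rewrite /q le_max lexx orbT.
have a0 : 0 <= a by rewrite aE divr_ge0 ?(ltW p1')// addr_ge0// mulr_ge0.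
have aE' : a * (1 - p) = sigma + 2 * q by rewrite aE divfK ?gt_eqF.
have d0 : 0 < k * (1 - p) by rewrite mulr_gt0.
have [Cz [Cz0 zC]] := zeta_growth d0 cz z0 (zlim _ d0).
(* Any N >= a gives th <= 1, so that r -> r^th is concave. *)
pose N := Num.bound a.
have aN : a < N%:R by exact: archi_boundP.
set th := a / (2 * N.+1%:R).
have th1 : th <= 1.
  rewrite ler_pdivrMr ?mulr_gt0// mul1r -natr1.
  have : 0 <= N%:R :> R by []. by lra.
have th0 : 0 <= th by rewrite divr_ge0 ?mulr_ge0.
have [C0 hC0] := mu_bounded sol (lexx 0).
pose Cs : R := n%:R `^ (sigma / 2).
pose A1 := `|C0| * (1 + n%:R) `^ (a / 2).
pose A2 := (4 * (Cz * Cs) / k) `^ (1 - p)^-1.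
(* A1 dominates the datum, A2 meets the largeness condition of the source, and 1 ensures
   positivity. *)
pose A := A1 + 1 + A2.
have A10 : 0 <= A1 by rewrite mulr_ge0 ?powR_ge0.
have A20 : 0 <= A2 by exact: powR_ge0.
have A0 : 0 < A by rewrite /A; lra.
have CC0 : 0 <= 4 * (Cz * Cs) / k.
  by rewrite divr_ge0 ?(ltW k0)// mulr_ge0// mulr_ge0 ?(ltW Cz0) ?powR_ge0.
have Ale : 4 * (Cz * Cs) / k <= A `^ (1 - p).
  have -> : 4 * (Cz * Cs) / k = A2 `^ (1 - p).
    by rewrite /A2 -powRrM mulVf ?powRr1// gt_eqF.
  by apply: ge0_ler_powR; rewrite ?nnegrE ?(ltW p1') ?(ltW A0)// /A; lra.
have CH0 := CH_ge0 R n N.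
(* The three terms give L >= 1 + t, CH/L <= 1 and CH/K <= k/2. *)
pose K := 1 + CH R n N + 2 * CH R n N / k.
have K2 : 0 <= 2 * CH R n N / k by rewrite divr_ge0 ?(ltW k0)// mulr_ge0.
have K0 : 0 < K by rewrite /K; lra.
have u0_le L x : 1 <= L -> u0 x <= A * HL N th L x.
  move=> L1; have := hC0 0 x; rewrite lexx expR0 mul1r (sol_init sol) => /(_ isT) h.
  apply: le_trans h _; have hw := @weight_le_HL R n N a L x L1 a0.
  apply: (@le_trans _ _ (`|C0| * (1 + enorm x ^+ 2) `^ (a / 2))).
    by rewrite ler_wpM2r ?powR_ge0// ler_norm.
  apply: le_trans (ler_wpM2l (normr_ge0 C0) hw) _; rewrite mulrA ler_wpM2r ?powR_ge0//.
  by rewrite /A -/A1; lra.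
(* kap compares the weight at radius rho with the one at radius 1. *)
pose kap := Num.min (rho ^+ 2) 1.
have kap0 : 0 < kap by rewrite lt_min ltr01 exprn_gt0.
have rhoE x : 1 + enorm x ^+ 2 <= kap^-1 * (rho ^+ 2 + enorm x ^+ 2).
  rewrite mulrC ler_pdivlMr// mulrC mulrDr mulr1 lerD//.
    by rewrite /kap ge_min lexx.
  by rewrite ler_piMl ?sqr_ge0// /kap ge_min lexx orbT.
pose Cu := A * (1 + n%:R) `^ th * K `^ (a / 2) * kap^-1 `^ (a / 2) * 2 `^ (a / 2 + k).
exists Cu; split.
  by rewrite !mulr_gt0 ?powR_gt0 ?invr_gt0// ltr_pwDl.
move=> t t1; have t0 : 0 <= t by lra.
(* The horizon is t itself: L follows t, while A and K do not depend on it. *)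
pose L := K * (1 + t).
have KL : 1 + t <= L by rewrite /L ler_peMl; rewrite /K; lra.
have L1 : 1 <= L by lra.
have CHK : CH R n N / K <= k / 2.
  rewrite ler_pdivrMr//; have : k / 2 * (2 * CH R n N / k) = CH R n N by field; rewrite gt_eqF.
  have : 0 <= k / 2 * (1 + CH R n N) by rewrite mulr_ge0 ?divr_ge0 ?(ltW k0)//; lra.
  rewrite /K; lra.
have E : CH R n N / L * (1 + t) = CH R n N / K.
  by rewrite /L; field; rewrite !gt_eqF//; lra.
have mub x : expR t * u x t <= A * Efun k t * HL N th L x.
  apply: (@upper_horizon R n N p a _ u0 u sol a0 th1 t A L k) => //.
  - by rewrite ler_pdivrMr; [rewrite mul1r /L /K; nra|lra].
  - by rewrite E.
  - by move=> y; exact: u0_le.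
  - by move=> y s s0'; rewrite mulr_ge0 ?powR_ge0// mulr_ge0 ?powR_ge0// ltW// z0.
  - move=> y s Phi z st Phi1 zz zle; have /andP[s0' _] := st.
    apply: (@nonlinear_supersolution N p nu sigma a A L t k Cz) => //; first exact: ltW.
    exact: zC.
  - by rewrite t0 lexx.
apply: wnorm_le => // x; have [u_ge0 _] := sol.
rewrite ger0_norm ?u_ge0//.
have ux : u x t <= A * (1 + t) `^ k * HL N th L x.
  rewrite -(ler_pM2l (expR_gt0 t)); apply: le_trans (mub x) _.
  by rewrite /Efun le_eqVlt; apply/orP; left; apply/eqP; ring.
apply: le_trans ux _.
have hl := @HL_le_weight R n N a L x L1 a0; rewrite -/th in hl.
have AA : 0 <= A * (1 + t) `^ k by rewrite mulr_ge0 ?powR_ge0 ?(ltW A0).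
apply: le_trans (ler_wpM2l AA hl) _.
have w1 : (1 + enorm x ^+ 2) `^ (a / 2) <=
    kap^-1 `^ (a / 2) * (rho ^+ 2 + enorm x ^+ 2) `^ (a / 2).
  rewrite -powRM ?invr_ge0 ?(ltW kap0)//; last by rewrite addr_ge0 ?sqr_ge0.
  apply: ge0_ler_powR; rewrite ?nnegrE ?rhoE//.
  - by rewrite divr_ge0.
  - by rewrite addr_ge0 ?sqr_ge0.
  - by rewrite mulr_ge0 ?invr_ge0 ?(ltW kap0)// addr_ge0 ?sqr_ge0.
have L2 : (1 + t) `^ k * L `^ (a / 2) <=
    K `^ (a / 2) * (2 `^ (a / 2 + k) * t `^ (a / 2 + k)).
  rewrite /L powRM ?(ltW K0)//; last by lra.
  rewrite mulrCA ler_wpM2l ?powR_ge0// -powRD; last by rewrite gt_eqF ?implybT//; lra.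
  rewrite -powRM// [k + _]addrC; apply: ge0_ler_powR; rewrite ?nnegrE.
  - by rewrite addr_ge0 ?divr_ge0 ?(ltW k0).
  - lra.
  - lra.
  - lra.
rewrite (_ : A * (1 + t) `^ k * _ = A * (1 + n%:R) `^ th * ((1 + t) `^ k * L `^ (a / 2)) *
   (1 + enorm x ^+ 2) `^ (a / 2)); last by ring.
rewrite (_ : Cu * _ * _ = A * (1 + n%:R) `^ th * (K `^ (a / 2) * (2 `^ (a / 2 + k) * t `^ (a / 2 + k))) *
  (kap^-1 `^ (a / 2) * (rho ^+ 2 + enorm x ^+ 2) `^ (a / 2))); last by rewrite /Cu; ring.
have An : 0 <= A * (1 + n%:R) `^ th by rewrite mulr_ge0 ?powR_ge0 ?(ltW A0).
apply: ler_pM => //; rewrite ?powR_ge0//.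
  by rewrite mulr_ge0// mulr_ge0 ?powR_ge0.
by rewrite ler_wpM2l.
Qed.

End upper_estimate.

(** * Lower bound *)

Section lower_estimate.
Variables (R : realType) (n : nat).

Section comparison.
Variables (p a : R) (V : 'rV[R]_n.+1 -> R -> R)
  (u0 : 'rV[R]_n.+1 -> R) (u : 'rV[R]_n.+1 -> R -> R).
Hypothesis sol : s_solution p a V u0 u.
Hypothesis a_ge0 : 0 <= a.
Hypothesis V_ge0 : forall y (t : R), 0 <= t -> 0 <= V y t.
Variables (B k : R).
Hypothesis B_ge0 : 0 <= B.
Hypothesis D_ge0 : 0 <= Dcos k.
Hypothesis u0_ge : forall x : 'rV[R]_n.+1, B * (1 / 3 - 2 / 3 * cos (k * x ord0 ord0)) <= u0 x.
Local Notation mu := (fun t x => expR t * u x t).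

(* Solution of the linear equation with datum [B (1/3 - 2/3 cos (k x_1))]. *)
Definition wlow (t : R) (x : 'rV[R]_n.+1) : R :=
  B * (1 / 3 * expR t - 2 / 3 * expR ((1 - Dcos k) * t) * cos (k * x ord0 ord0)).

(** This majorant provides the finiteness required by [opB_cos_lower]. *)
Lemma mu_poly_bound T : 0 <= T -> exists N C, 0 <= C /\
  forall (t : R) (y : 'rV[R]_n.+1), 0 <= t <= T -> mu t y <= C + C * \sum_i pow2 N (y ord0 i).
Proof.
move=> T0; have [C hC] := mu_bounded sol T0.
pose N := Num.bound a; have aN : a < N%:R by exact: archi_boundP.
have th1 : a / (2 * N.+1%:R) <= 1.
  rewrite ler_pdivrMr ?mulr_gt0// mul1r -natr1.
  have : 0 <= N%:R :> R by []. by lra.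
pose C' := `|C| * (1 + n.+1%:R) `^ (a / 2).
exists N, C'; split; first by rewrite mulr_ge0 ?powR_ge0.
move=> t y tT; apply: le_trans (hC t y tT) _.
apply: (@le_trans _ _ (`|C| * (1 + enorm y ^+ 2) `^ (a / 2))).
  by rewrite ler_wpM2r ?powR_ge0// ler_norm.
have hw := @weight_le_HL R n.+1 N a 1 y (lexx 1) a_ge0.
apply: le_trans (ler_wpM2l (normr_ge0 C) hw) _; rewrite mulrA -/C'.
have -> : C' + C' * \sum_i pow2 N (y ord0 i) = C' * XL N 1 y.
  by rewrite /XL expr1n; ring.
rewrite ler_wpM2l ?mulr_ge0 ?powR_ge0//; apply: ler1_powR => //.
exact: XL_geL.
Qed.

(** An error Phi e^{2s} integrates to at most (Phi/2) e^{2t}, so one pass through the integral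
    equation halves it, while [wlow] reproduces itself. The source is nonnegative and is dropped. *)
Lemma lower_step (Phi t : R) (x : 'rV[R]_n.+1) : 0 <= Phi -> 0 <= t ->
  (forall (s : R) y, 0 <= s -> wlow s y - Phi * expR (2 * s) <= mu s y) ->
  wlow t x - Phi / 2 * expR (2 * t) <= mu t x.
Proof.
move=> Phi0 t0 bnd; have [u_ge0 [_ [_ eqn]]] := sol.
have mu0 (s : R) y : 0 <= s -> 0 <= mu s y.
  by move=> s0; rewrite mulr_ge0 ?expR_ge0// u_ge0.
have [N [C [C0 hC]]] := mu_poly_bound t0.
set q := cos (k * x ord0 ord0).
pose g (s : R) : R := B / 3 * expR s - Phi * expR (2 * s) -
  B * (2 / 3) * expR ((1 - Dcos k) * s) * ((1 - Dcos k) * q).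
pose G (s : R) : R := B / 3 * expR s - Phi / 2 * expR (2 * s) -
  B * (2 / 3) * q * expR ((1 - Dcos k) * s).
have dexp (r s : R) : is_derive s 1 (fun v => expR (r * v)) (r * expR (r * s)).
  have h1 : is_derive s 1 (fun v : R => r * v) r.
    have h := @is_deriveZ _ _ _ id r s 1 _ (is_derive_id s 1).
    by apply: (@is_derive_eq _ _ _ _ _ _ _ _ h); rewrite /GRing.scale/= mulr1.
  have h2 := @is_derive1_comp _ expR (fun v : R => r * v) s _ _ (is_derive_expR _) h1.
  by apply: (@is_derive_eq _ _ _ _ _ _ _ _ h2); rewrite mulrC.
have cexp (r s : R) : {for s, continuous (fun v : R => expR (r * v))}.
  have [d _] := dexp r s.
  exact/differentiable_continuous/derivable1_diffP.
have dG (s : R) : 0 <= s <= t -> is_derive s 1 G (g s).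
  move=> _.
  have h1 := @is_deriveZ _ _ _ expR (B / 3) s 1 _ (is_derive_expR s).
  have h2 := @is_deriveZ _ _ _ _ (Phi / 2) s 1 _ (dexp 2 s).
  have h3 := @is_deriveZ _ _ _ _ (B * (2 / 3) * q) s 1 _ (dexp (1 - Dcos k) s).
  have h := is_deriveB (is_deriveB h1 h2) h3.
  apply: (@is_derive_eq _ _ _ _ _ _ _ _ h).
  by rewrite /g /GRing.scale/=; field.
have cg : {within `[0, t], continuous g}.
  apply: continuous_subspaceT => s.
  apply: cvgB; [apply: cvgB|]; apply: cvgM; try exact: cvg_cst.
  - exact: continuous_expR.
  - exact: cexp.
  - by apply: cvgM; [exact: cvg_cst|exact: cexp].
have intg := Rint_FTC t0 dG cg.
have i1 : Defs.Rint `[0, t] g <= Defs.Rint `[0, t] (fun s => opB (mu s) x).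
  pose M := C + C * \sum_i (pow2 N (x ord0 i) + CB R N * (1 + (x ord0 i ^+ 2) ^+ N)).
  apply: (Rint_ge (C := M) cg).
  move=> s st; have /andP[s0 _] := st.
  have mus0 y := mu0 s y s0; have muC y := hC s y st.
  split; first exact: opB_ge0; last exact: opB_poly_upper.
  have := @opB_cos_lower R n N (mu s) C C (B / 3 * expR s - Phi * expR (2 * s))
    (B * (2 / 3) * expR ((1 - Dcos k) * s)) k x mus0 C0 C0 muC.
  apply; first by rewrite ?(expR_ge0, mulr_ge0, divr_ge0).
  by move=> y; apply: le_trans (bnd s y s0); rewrite /wlow; lra.
have i2 : 0 <= Defs.Rint `[0, t] (fun tau => expR ((1 - p) * tau) *
    opB (fun y => V y tau * mu tau y `^ p) x).
  apply: Rintegral_ge0 => s /=; rewrite in_itv/= => /andP[s0 _].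
  rewrite mulr_ge0 ?expR_ge0//; apply: opB_ge0 => y.
  by rewrite mulr_ge0 ?powR_ge0// V_ge0.
rewrite (eqn t x t0).
have := u0_ge x; rewrite -/q => hu0.
have G0 : G 0 = B / 3 - Phi / 2 - B * (2 / 3) * q by rewrite /G !mulr0 expR0 !mulr1.
have GE : wlow t x - Phi / 2 * expR (2 * t) = G t by rewrite /wlow /G -/q; lra.
rewrite GE; rewrite intg G0 in i1.
set I1 := Defs.Rint _ _ in i1 *; set I2 := Defs.Rint _ _ in i2 *.
lra.
Qed.

(** The iteration starts from Phi = B, as [wlow] is at most B e^{2s} and mu is nonnegative; after j
    passes the error factor is B/2^j. *)
Lemma lower_compare (t : R) (x : 'rV[R]_n.+1) : 0 <= t -> wlow t x <= mu t x.
Proof.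
move=> t0; have [u_ge0 _] := sol.
have D0 := D_ge0; have B0 := B_ge0.
have it j : forall (s : R) y, 0 <= s -> wlow s y - B / 2 ^+ j * expR (2 * s) <= mu s y.
  elim: j => [|j IH] s y s0.
    rewrite expr0 divr1; apply: (@le_trans _ _ 0); last by rewrite mulr_ge0 ?expR_ge0 ?u_ge0.
    have e1 : expR ((1 - Dcos k) * s) <= expR s.
      by rewrite ler_expR ler_piMl//; lra.
    have e2 : expR s <= expR (2 * s) by rewrite ler_expR; lra.
    rewrite /wlow; set q := cos _; have q1 : -1 <= q by exact: cos_geN1.
    have e0 := expR_ge0 ((1 - Dcos k) * s).
    have h : - (2 / 3 * expR ((1 - Dcos k) * s) * q) <= 2 / 3 * expR s.
      have := ler_wpM2l e0 q1; lra.
    rewrite -mulrBr mulr_ge0_le0//; lra.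
  have P0 : 0 <= B / 2 ^+ j by rewrite divr_ge0 ?exprn_ge0.
  have := @lower_step _ s y P0 s0 IH.
  by rewrite (_ : B / 2 ^+ j / 2 = B / 2 ^+ j.+1)// exprSr invfM mulrA.
rewrite leNgt; apply/negP => lt.
set d := wlow t x - mu t x; have d0 : 0 < d by rewrite subr_gt0.
set Z := B * expR (2 * t).
have Z0 : 0 <= Z by rewrite mulr_ge0 ?expR_ge0.
have Zd : 0 <= Z / d by rewrite divr_ge0 ?(ltW d0).
pose j := Num.bound (Z / d).
have hj : Z / d < j%:R by exact: archi_boundP.
have hj2 : j%:R <= 2 ^+ j :> R by rewrite -natrX ler_nat ltnW// ltn_expl.
have P : 0 < 2 ^+ j :> R by rewrite exprn_gt0.
have Qd : B / 2 ^+ j * expR (2 * t) < d.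
  rewrite mulrAC -/Z ltr_pdivrMr// mulrC -ltr_pdivrMr//.
  exact: lt_le_trans hj hj2.
by have := it j t x t0; rewrite lerBlDr addrC -lerBlDr leNgt Qd.
Qed.

End comparison.

(** By time t the origin feels the datum at distance r of order sqrt t, where it is of size r^a,
    that is, of order t^{a/2}. *)
Lemma lower_wnorm (p a l1 rho : R) (V : 'rV[R]_n.+1 -> R -> R)
  (u0 : 'rV[R]_n.+1 -> R) (u : 'rV[R]_n.+1 -> R -> R) :
  s_solution p a V u0 u -> 0 <= a -> (forall y (t : R), 0 <= t -> 0 <= V y t) ->
  (forall x, 0 <= u0 x) -> 0 < l1 -> 0 < rho ->
  liminf_infty (fun x => enorm x `^ (- a) * u0 x) l1 ->
  exists Cl : R, 0 < Cl /\ exists T : R, forall t, T <= t ->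
    Cl * t `^ (a / 2) <= wnorm rho a (fun x => u x t).
Proof.
move=> sol a0 V0 u00 l10 rho0 [linf _].
have l2 : 0 < l1 / 2 by lra.
have [M hM] := linf _ l2.
have [c [c0 hc]] := Dcos_lower R.
pose M' := Num.max M 1.
have M1 : 1 <= M' by rewrite le_max lexx orbT.
have MM : M <= M' by rewrite le_max lexx.
pose Cl := (rho ^+ 2) `^ (- (a / 2)) * (l1 / 2 / 6 * (c / 3) `^ (a / 2)).
exists Cl; split.
  rewrite mulr_gt0 ?powR_gt0 ?exprn_gt0// mulr_gt0 ?powR_gt0 ?divr_gt0//.
(* This threshold gives r >= M': then k = 1/r <= 1, and the datum is at least (l1/2)|x|^a beyond
   radius r. *)
exists (M' ^+ 2 * 3 / c) => t tT.
have t0 : 0 < t by apply: lt_le_trans tT; rewrite divr_gt0// mulr_gt0// exprn_gt0//; lra.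
(* The 3 makes Dcos k * t >= 3, hence e^{-Dt} <= 1/(1 + 3), which leaves 1/3 - (2/3)(1/4) = 1/6 at
   the origin. *)
pose r := Num.sqrt (c / 3 * t).
have ct0 : 0 < c / 3 * t by rewrite mulr_gt0 ?divr_gt0.
have r2 : r ^+ 2 = c / 3 * t by rewrite sqr_sqrtr// ltW.
have rM : M' <= r.
  rewrite -(@ler_pXn2r _ 2)// ?nnegrE ?sqrtr_ge0//; last by lra.
  by rewrite r2; move: tT; rewrite ler_pdivrMr//; lra.
have r1 : 1 <= r by exact: le_trans M1 rM.
have rp : 0 < r by lra.
pose k := r^-1.
have k01 : 0 <= k <= 1 by rewrite invr_ge0 (ltW rp)/= invf_le1.
have hD := hc k k01.
have Dt : 3 <= Dcos k * t.
  apply: (@le_trans _ _ (c * k ^+ 2 * t)); last by rewrite ler_wpM2r// ltW.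
  rewrite /k exprVn r2 le_eqVlt; apply/orP; left; apply/eqP; field.
  by rewrite !gt_eqF.
have D0 : 0 <= Dcos k by apply: le_trans hD; rewrite mulr_ge0 ?(ltW c0)// sqr_ge0.
pose B := l1 / 2 * r `^ a.
have B0 : 0 <= B by rewrite mulr_ge0 ?powR_ge0 ?(ltW l2).
have u0_ge (x : 'rV[R]_n.+1) : B * (1 / 3 - 2 / 3 * cos (k * x ord0 ord0)) <= u0 x.
  (* For |x_1| <= r the cosine is at least 1/2 and the left side is nonpositive; otherwise |x| > r
     and the left side is at most B. *)
  have [xr|rx] := leP `|x ord0 ord0| r.
    apply: (@le_trans _ _ 0); last exact: u00.
    rewrite mulr_ge0_le0//.
    have kx : `|k * x ord0 ord0| <= 1.
      by rewrite normrM gtr0_norm ?invr_gt0// mulrC ler_pdivrMr// mul1r.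
    by have := cos_ge_half kx; lra.
  have ex : r <= enorm x.
    apply: le_trans (ltW rx) _; rewrite -sqrtr_sqr ler_wsqrtr//.
    rewrite (bigD1 ord0)//= lerDl sumr_ge0// => i _; exact: sqr_ge0.
  have ep : 0 < enorm x by lra.
  have := hM x (le_trans MM (le_trans rM ex)).
  rewrite powRN [leRHS]mulrC ler_pdivlMr ?powR_gt0// => h.
  have ra : r `^ a <= enorm x `^ a.
    by apply: ge0_ler_powR; rewrite ?nnegrE ?(ltW rp) ?(ltW ep).
  have h2 : B <= u0 x.
    by apply: le_trans h; rewrite (_ : l1 - l1 / 2 = l1 / 2) ?ler_wpM2l ?(ltW l2)//; field.
  apply: le_trans h2; rewrite ler_piMr//.
  by have := cos_geN1 (k * x ord0 ord0); lra.
have low := @lower_compare p a V u0 u sol a0 V0 B k B0 D0 u0_ge t 0 (ltW t0).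
rewrite /wlow mxE mulr0 cos0 mulr1 in low.
have e4 : expR ((1 - Dcos k) * t) <= expR t / 4.
  rewrite (_ : (1 - Dcos k) * t = t - Dcos k * t); last by ring.
  rewrite expRB ler_wpM2l ?expR_ge0// lef_pV2 ?posrE ?expR_gt0//.
  by have := expR_ge1Dx (Dcos k * t); lra.
have ulow : B / 6 <= u 0 t.
  rewrite -(ler_pM2l (expR_gt0 t)); apply: le_trans low.
  have := ler_wpM2l B0 e4; lra.
have [_ [bc _]] := sol; have [_ [C hC]] := bc t (ltW t0).
have rE (x : 'rV[R]_n.+1) : (1 + enorm x ^+ 2) `^ (a / 2) <=
    (1 + rho^-1 ^+ 2) `^ (a / 2) * (rho ^+ 2 + enorm x ^+ 2) `^ (a / 2).
  have e0 := sqr_ge0 (@enorm R n.+1 x); have i0 := sqr_ge0 rho^-1; have rr := sqr_ge0 rho.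
  rewrite -powRM ?addr_ge0//; apply: ge0_ler_powR; rewrite ?nnegrE ?divr_ge0 ?addr_ge0//.
    by rewrite mulr_ge0 ?addr_ge0.
  have : rho^-1 ^+ 2 * rho ^+ 2 = 1 by rewrite -exprMn mulVf ?expr1n// gt_eqF.
  have := mulr_ge0 i0 e0; lra.
(* The set defining the norm at radius rho is thereby bounded, so its supremum controls the value at
   the origin. *)
have bnd (x : 'rV[R]_n.+1) : `|u x t| <= (expR (- t) * `|C| * (1 + rho^-1 ^+ 2) `^ (a / 2)) *
    (rho ^+ 2 + enorm x ^+ 2) `^ (a / 2).
  have := hC x; rewrite normrM gtr0_norm ?expR_gt0// => h.
  have h2 : expR t * `|u x t| <= `|C| * (1 + enorm x ^+ 2) `^ (a / 2).
    by apply: le_trans h _; rewrite ler_wpM2r ?powR_ge0// ler_norm.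
  have h3 := ler_wpM2l (normr_ge0 C) (rE x).
  rewrite expRN -!mulrA mulrC ler_pdivlMr ?expR_gt0// mulrC.
  by apply: le_trans h2 _; apply: le_trans h3 _; rewrite mulrA.
have := le_wnorm 0 rho0 bnd.
have -> : enorm (0 : 'rV[R]_n.+1) ^+ 2 = 0.
  by rewrite enorm_sqr big1// => i _; rewrite mxE expr0n.
have u0t : 0 <= u 0 t by have [+ _] := sol; apply; exact: ltW.
rewrite addr0 (ger0_norm u0t) => hw.
rewrite /Cl powRN -mulrA mulrC ler_pdivrMr ?powR_gt0 ?exprn_gt0//.
apply: le_trans hw; apply: le_trans ulow.
have -> : B = l1 / 2 * ((c / 3) `^ (a / 2) * t `^ (a / 2)).
  rewrite /B -powRM ?divr_ge0 ?(ltW c0) ?(ltW t0)// -r2 -powR_mulrn ?(ltW rp)// -powRrM.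
  by congr (_ * _ `^ _); field.
lra.
Qed.

End lower_estimate.

Theorem mainTheorem9 (R : realType) (n : nat) (p nu sigma : R)
  (zeta : R -> R) (u0 : 'rV[R]_n -> R) (u : 'rV[R]_n -> R -> R)
  (l1 l2 rho : R) :
  (1 <= n)%N -> 0 < p < 1 -> Jplus n sigma ->
  {within `[0, +oo[, continuous zeta} ->
  (forall t, 0 <= t -> 0 < zeta t) ->
  (forall delta : R, 0 < delta -> (t `^ delta * zeta t) @[t --> +oo] --> +oo) ->
  (forall delta : R, 0 < delta -> (t `^ (- delta) * zeta t) @[t --> +oo] --> 0) ->
  (0 < sigma -> exists eps : R, 0 < eps < 1 /\
      classE eps (fun t => zeta t * (1 + t) `^ nu)) ->
  let a := (sigma + 2 * Num.max (nu + 1) 0) / (1 - p) in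
  let V := fun (x : 'rV[R]_n) (t : R) => zeta t * (1 + t) `^ nu * enorm x `^ sigma in
  continuous u0 -> (forall x, 0 <= u0 x) ->
  0 < l1 -> 0 < l2 ->
  liminf_infty (fun x => enorm x `^ (- a) * u0 x) l1 ->
  limsup_infty (fun x => enorm x `^ (- a) * u0 x) l2 ->
  s_solution p a V u0 u ->
  0 < rho ->
  exists Cl : R, 0 < Cl /\
  forall eps' : R, 0 < eps' -> exists Cu : R, 0 < Cu /\
    exists T : R, forall t, T <= t ->
      Cl * l1 * t `^ (a / 2) <= wnorm rho a (fun x => u x t) /\
      wnorm rho a (fun x => u x t) <= Cu * l2 * t `^ (a / 2 + eps').
Proof.
case: n u0 u => // n u0 u _ p01 Js cz z0 _ zlim _ a V _ u00 l10 l20 linf _ sol rho0.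
have s0 : 0 <= sigma.
  by move: Js; rewrite /Jplus; case: ifP => // _ [->//|]; lra.
have /andP[p0 p1] := p01.
have a0 : 0 <= a.
  rewrite /a divr_ge0//; last by lra.
  by rewrite addr_ge0// mulr_ge0// le_max lexx orbT.
have V0 y (t : R) : 0 <= t -> 0 <= V y t.
  by move=> t0; rewrite !mulr_ge0 ?powR_ge0// ltW// z0.
have [Cl [Cl0 [T hT]]] := lower_wnorm sol a0 V0 u00 l10 rho0 linf.
(* The estimates come without the factors l1 and l2; dividing the constants by them gives the stated
   form. *)
exists (Cl / l1); split; first by rewrite divr_gt0.
move=> eps' e0.
have [Cu [Cu0 hCu]] := upper_wnorm p01 s0 erefl cz z0 zlim sol rho0 e0.
exists (Cu / l2); split; first by rewrite divr_gt0.
exists (Num.max T 1) => t; rewrite ge_max => /andP[tT t1].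
rewrite !divfK ?gt_eqF//; split; [exact: hT|exact: hCu].
Qed.
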